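(* Let $(X_t)_{t\ge 0}$ be a (possibly time-inhomogeneous) continuous-time Markov process with values in a measurable space $(E,\mathcal{E})$, let $P_0,Q_0$ be two probability measures on $E$, and let $U:[0,\infty)\to\mathbb{R}$ be convex with $\inf U>-\infty$. Denote by $P_t$ and $Q_t$ the time-$t$ marginal laws of the process when the initial law is $P_0$ and $Q_0$ respectively, by $(X^P_t)_{t\ge 0}$, $(X^Q_t)_{t\geq 0}$ realizations of the process with $X_0$ distributed according to $P_0$, $Q_0$ respectively, and let $\mathcal{F}_s=\sigma(X^Q_r,\ r\ge s)$. (1) If $P_t\ll Q_t$ for some $t\ge 0$, then the law of $(X^P_r)_{r\ge t}$ is absolutely continuous with respect to the law of $(X^Q_r)_{r\ge t}$, $P_s\ll Q_s$ for all $s\ge t$, and $\left(\frac{dP_s}{dQ_s}(X^Q_s)\right)_{s\ge t}$ is a backward martingale with respect to $(\mathcal{F}_s)_{s\ge t}$. (2) If $H_U(P_t|Q_t)<+\infty$ for some $t\ge 0$, then $P_s\ll Q_s$ for all $s\ge t$ and $\left(U\left(\frac{dP_s}{dQ_s}(X^Q_s)\right)\right)_{s\ge t}$ is a backward submartingale with respect to $(\mathcal{F}_s)_{s\ge t}$. Moreover $s\mapsto H_U(P_s|Q_s)$ is non-increasing, and $$H_U(P_s|Q_s)=\mathbb{E}\left(U\left(\frac{dP_s}{dQ_s}(X^Q_s)\right)\right)\underset{s\to\infty}{\longrightarrow}\mathbb{E}\left(U\left(\mathbb{E}\left(\frac{dP_t}{dQ_t}(X^Q_t)\,\Big|\,\bigcap_{s\ge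 0}\mathcal{F}_s\right)\right)\right)<\infty .$$
   Context: For probability measures $p,q$ on $(E,\mathcal{E})$, the $U$-entropy is $H_U(p|q)=\int_E U\left(\frac{dp}{dq}\right)dq$ if $p\ll q$ and $H_U(p|q)=+\infty$ otherwise. An integrable process $(Z_s)_{s\ge t}$ with $Z_s$ $\mathcal{F}_s$-measurable, where $(\mathcal{F}_s)$ is a decreasing family of sigma-fields, is a backward martingale (resp. backward submartingale) if $\mathbb{E}(Z_r|\mathcal{F}_s)=Z_s$ (resp. $\ge Z_s$) a.s. for all $t\le r\le s$. *)

(* Defs.v *)
From HB Require Import structures.
From mathcomp Require Import all_boot all_order all_algebra.
From mathcomp Require Import all_classical all_reals all_analysis.

Set Implicit Arguments.
Unset Strict Implicit.
Unset Printing Implicit Defensive.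

Import Order.TTheory GRing.Theory Num.Theory.
Import numFieldNormedType.Exports.

Local Open Scope classical_set_scope.
Local Open Scope ring_scope.
Local Open Scope ereal_scope.

(* Processes are indexed by all of R for convenience; their values at negative
   times are never used. *)
Definition sigma_process d d' (W : measurableType d) (E : measurableType d')
    (R : realType) (X : R -> {mfun W >-> E}) (D : set R) : set (set W) :=
  <<s \bigcup_(r in D) preimage_set_system setT (X r) measurable >>.

Definition past d d' (W : measurableType d) (E : measurableType d')
    (R : realType) (X : R -> {mfun W >-> E}) (s : R) : set (set W) :=
  sigma_process X [set r | (0 <= r <= s)%R].

Definition future d d' (W : measurableType d) (E : measurableType d')
    (R : realType) (X : R -> {mfun W >-> E}) (s : R) : set (set W) :=
  sigma_process X [set r | (s <= r)%R].

(* Real functions measurable for a sigma-field G other than the canonical one. *)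
Definition sub_measurable (W : Type) (R : realType) (G : set (set W))
    (f : W -> R) : Prop :=
  preimage_set_system setT f measurable `<=` G.

(* g is a version of the conditional expectation E(f | G). *)
Definition is_cond_exp d (W : measurableType d) (R : realType)
    (P : probability W R) (G : set (set W)) (f g : W -> R) : Prop :=
  [/\ sub_measurable G g,
      P.-integrable setT (EFin \o g) &
      forall B, G B -> \int[P]_(w in B) (g w)%:E = \int[P]_(w in B) (f w)%:E].

Definition backward_filtration d (W : measurableType d) (R : realType) (t : R)
    (F : R -> set (set W)) : Prop :=
  (forall s, (t <= s)%R -> sigma_algebra setT (F s) /\ F s `<=` measurable) /\
  (forall r s, (t <= r)%R -> (r <= s)%R -> F s `<=` F r).

Definition backward_integrable_adapted d (W : measurableType d) (R : realType)
    (P : probability W R) (t : R) (F : R -> set (set W)) (Z : R -> W -> R)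
    : Prop :=
  backward_filtration t F /\
  forall s, (t <= s)%R ->
    sub_measurable (F s) (Z s) /\ P.-integrable setT (EFin \o Z s).

Definition backward_martingale d (W : measurableType d) (R : realType)
    (P : probability W R) (t : R) (F : R -> set (set W)) (Z : R -> W -> R)
    : Prop :=
  backward_integrable_adapted P t F Z /\
  forall r s, (t <= r)%R -> (r <= s)%R ->
    exists2 g, is_cond_exp P (F s) (Z r) g & {ae P, forall w, g w = Z s w}.

Definition backward_submartingale d (W : measurableType d) (R : realType)
    (P : probability W R) (t : R) (F : R -> set (set W)) (Z : R -> W -> R)
    : Prop :=
  backward_integrable_adapted P t F Z /\
  forall r s, (t <= r)%R -> (r <= s)%R ->
    exists2 g, is_cond_exp P (F s) (Z r) g & {ae P, forall w, (g w >= Z s w)%R}.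

(* Transition probabilities of a time-inhomogeneous Markov process: k s t x is
   the law at time t of the process started from x at time s, for 0 <= s < t
   (the values of k at other pairs of times are irrelevant). *)
Definition chapman_kolmogorov d (E : measurableType d) (R : realType)
    (k : R -> R -> R.-pker E ~> E) : Prop :=
  forall s t u, (0 <= s)%R -> (s < t)%R -> (t < u)%R ->
  forall x A, measurable A -> k s u x A = \int[k s t x]_y k t u y A.

Definition markov_process d d' (E : measurableType d) (W : measurableType d')
    (R : realType) (k : R -> R -> R.-pker E ~> E) (P0 : probability E R)
    (P : probability W R) (X : R -> {RV P >-> E}) : Prop :=
  (forall A, measurable A -> distribution P (X 0%R) A = P0 A) /\
  (forall s t, (0 <= s)%R -> (s < t)%R -> forall A, measurable A ->
    is_cond_exp P (past X s)
      (\1_(X t @^-1` A) : W -> R) (fun w => fine (k s t (X s w) A))).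

(* E-valued paths indexed by [t, +oo[, with the product sigma-field. *)
Definition cylinder d (E : measurableType d) (R : realType) (t : R)
    : set (set ({r : R | (t <= r)%R} -> E)) :=
  \bigcup_r preimage_set_system setT (fun x => x r) measurable.

Notation path_space E t := (g_sigma_algebraType (@cylinder _ E _ t)).

Section path_from.
Context d d' (W : measurableType d) (E : measurableType d') (R : realType).
Variables (X : R -> {mfun W >-> E}) (t : R).

Definition path_from (w : W) : path_space E t := fun r => X (sval r) w.

Let measurable_path_from : measurable_fun setT path_from.
Proof.
apply: (@measurability _ _ _ _ setT path_from (@cylinder _ E R t)) => //.
move=> _ [_ [r _ [B mB <-]] <-].
have -> : setT `&` path_from @^-1`
    (setT `&` (fun x : {r : R | (t <= r)%R} -> E => x r) @^-1` B)
    = setT `&` X (sval r) @^-1` B.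
  by rewrite !setTI.
exact: measurable_funPT.
Qed.

HB.instance Definition _ :=
  isMeasurableFun.Build _ _ _ _ path_from measurable_path_from.
End path_from.
Arguments path_from {d d' W E R} X t w.

(* An everywhere nonnegative version of dp/dq: the Radon-Nikodym derivative of
   the library is only q-almost everywhere nonnegative. *)
Definition density d (E : measurableType d) (R : realType)
    (p q : probability E R) (x : E) : R :=
  Num.max 0%R (fine (Radon_Nikodym (charge_of_finite_measure p) q x)).

Definition U_entropy d (E : measurableType d) (R : realType) (U : R -> R)
    (p q : probability E R) : \bar R :=
  if `[< p `<< q >] then \int[q]_x (U (density p q x))%:E else +oo.

(* Main.v *)
(** Both processes have the same transitions, so the law of the path of X^P after
    time t is the law of the path of X^Q after t reweighted by Z_t, where
    Z_t = dP_t/dQ_t(X^Q_t); this is checked on finite cylinders and extended by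
    the pi-lambda theorem. Since the events of F_s only depend on the path after
    s, comparing the reweightings at r <= s gives E(Z_r | F_s) = Z_s.

    The submartingale property is the conditional Jensen inequality, obtained from
    countably many rational affine minorants of U; a possible jump of U at 0 is
    harmless because Z_r vanishes almost surely where E(Z_r | F_s) does.

    For the limit, nonincreasing entropies reduce the claim to a subsequence. The
    quantities E(1 / (1 + Z_n)) are monotone, and strict convexity of
    x |-> 1 / (1 + x) turns their convergence into summable L^1 increments of
    1 / (1 + Z_n) along a subsequence, hence almost sure convergence of Z_n to
    E(Z_t | tail). The same applies to E(U(Z_t) | F_n), which dominates U(Z_n), so
    Fatou's lemma for the difference gives the limit of E(U(Z_n)). *)

Require Import Defs.
From HB Require Import structures.
From mathcomp Require Import all_boot all_order all_algebra.
From mathcomp Require Import all_classical all_reals all_analysis.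
From mathcomp Require Import measurable_realfun ring lra.

Set Implicit Arguments.
Unset Strict Implicit.
Unset Printing Implicit Defensive.

Import Order.TTheory GRing.Theory Num.Theory.
Import numFieldNormedType.Exports.

Local Open Scope classical_set_scope.
Local Open Scope ring_scope.
Local Open Scope ereal_scope.

(** The reweighting is stated for whole paths because that single identity yields domination of the
    path laws, domination at all later times and the backward martingale property together. The map
    [x |-> 1 / (1 + x)] is chosen for two reasons. It is bounded on the half-line, so no square
    integrability of the density is required. It is also injective and tends to 0 only at infinity,
    so convergence of the transforms can be undone as soon as the lower limit of the original
    sequence is finite; upcrossing inequalities are thereby avoided. Almost sure convergence does
    not by itself pass to expectations of [U], which may grow arbitrarily fast. Conditional
    expectations of [U(Z_t)] serve as a moving dominating sequence: they all have the same integral,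
    so they cancel after Fatou's lemma, in place of uniform integrability. Since nothing is known
    about [U] on negative reals, densities and conditional expectations are chosen nonnegative
    everywhere and not just almost everywhere. *)

Section measurable_induction.
Context d (T : measurableType d) (R : realType).
Import HBNNSimple.

(** Packages the approximation by simple functions once, so that a formula known for indicators
    extends to nonnegative functions by linearity and monotone limits. It serves both for changes of
    variables and for the Markov property. *)
Lemma ge0_measurable_ind (P : (T -> \bar R) -> Prop) :
  (forall A : set T, measurable A -> P (fun x => (\1_A x)%:E)) ->
  (forall (c : R) (f : T -> \bar R), (0 <= c)%R -> measurable_fun setT f ->
    (forall x, 0 <= f x) -> P f -> P (fun x => c%:E * f x)) ->
  (forall f g : T -> \bar R, measurable_fun setT f -> measurable_fun setT g ->
    (forall x, 0 <= f x) -> (forall x, 0 <= g x) -> P f -> P g -> P (f \+ g)) ->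
  (forall f_ : (T -> \bar R)^nat, (forall n, measurable_fun setT (f_ n)) ->
    (forall n x, 0 <= f_ n x) -> (forall x, nondecreasing_seq (f_ ^~ x)) ->
    (forall n, P (f_ n)) -> P (fun x => limn (f_ ^~ x))) ->
  forall f : T -> \bar R, measurable_fun setT f -> (forall x, 0 <= f x) -> P f.
Proof.
move=> P1 PZ PD Plim f mf f0.
pose f_ := nnsfun_approx measurableT mf.
have -> : f = (fun x => limn (fun n => (f_ n x)%:E)).
  apply/funext => x; apply/esym/cvg_lim => //.
  exact: cvg_nnsfun_approx.
apply: (Plim (fun n x => (f_ n x)%:E)).
- by move=> n; exact/measurable_EFinP.
- by move=> n x; rewrite lee_fin.
- by move=> x m n mn; rewrite lee_fin; exact/lefP/nd_nnsfun_approx.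
move=> n; move: (f_ n) => g {Plim f_ mf f0 f}.
have -> : (fun x => (g x)%:E) =
    (fun x => \sum_(y <- (finmap.enum_fset (fset_set (range g)))) y%:E * (\1_(g @^-1` [set y]) x)%:E).
  by apply/funext => x; rewrite fimfunE fsbig_finite//= sumEFin.
have : forall y, y \in (finmap.enum_fset (fset_set (range g))) -> (0 <= y)%R.
  by move=> y; rewrite in_fset_set// inE => -[x _ <-].
have mi y : measurable_fun setT (fun x => (\1_(g @^-1` [set y]) x : R)%:E).
  exact/measurable_EFinP.
have mpre y : measurable (g @^-1` [set y]) by exact: measurable_funPTI.
elim: (finmap.enum_fset (fset_set (range g))) => [_|y s ih ys].
  (* The zero function is reached through the closure hypotheses as 0 times an indicator. *)
  have -> : (fun x => \sum_(y <- [::]) y%:E * (\1_(g @^-1` [set y]) x)%:E) =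
      (fun x => 0%:E * (\1_(set0 : set T) x)%:E).
    by apply/funext => x; rewrite big_nil mul0e.
  apply: PZ => //; [exact/measurable_EFinP|exact: P1].
have -> : (fun x => \sum_(y <- y :: s) y%:E * (\1_(g @^-1` [set y]) x)%:E) =
    (fun x => y%:E * (\1_(g @^-1` [set y]) x)%:E) \+
    (fun x => \sum_(y <- s) y%:E * (\1_(g @^-1` [set y]) x)%:E).
  by apply/funext => x; rewrite big_cons.
have y0 : (0 <= y)%R by apply: ys; rewrite mem_head.
have {}ys z : z \in s -> (0 <= z)%R by move=> zs; apply: ys; rewrite inE zs orbT.
apply: PD.
- exact: measurable_funeM.
- by apply: emeasurable_sum => z; exact: measurable_funeM.
- by move=> x; rewrite mule_ge0// lee_fin.
- move=> x; rewrite big_seq; apply: sume_ge0 => z zs.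
  by rewrite mule_ge0 ?lee_fin// ys.
- by apply: PZ => //; exact: P1.
- exact: ih.
Qed.

End measurable_induction.

(** Change of variables when the image under [X] of [mu] restricted to [D] has density [h] with
    respect to [nu]. The path law computation uses it with [h] a Radon-Nikodym derivative, a
    transition probability ([D] being then an event of later times), and the constant 1. *)
Lemma ge0_integral_comp_density d d' (W : measurableType d)
    (E : measurableType d') (R : realType) (mu : {measure set W -> \bar R})
    (nu : {measure set E -> \bar R}) (X : W -> E) (D : set W) (h : E -> \bar R) :
  measurable_fun setT X -> measurable D ->
  measurable_fun setT h -> (forall x, 0 <= h x) ->
  (forall A, measurable A -> mu (X @^-1` A `&` D) = \int[nu]_(x in A) h x) ->
  forall f : E -> \bar R, measurable_fun setT f -> (forall x, 0 <= f x) ->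
  \int[mu]_(w in D) f (X w) = \int[nu]_x (f x * h x).
Proof.
move=> mX mD mh h0 muh.
have mfX (f : E -> \bar R) : measurable_fun setT f ->
    measurable_fun D (fun w => f (X w)).
  by move=> mf; apply: measurable_funTS; exact: measurableT_comp.
apply: ge0_measurable_ind.
- move=> A mA.
  have mXA : measurable (X @^-1` A) by rewrite -[X in measurable X]setTI; exact: mX.
  transitivity (\int[mu]_(w in D) (\1_(X @^-1` A) w)%:E) => //.
  rewrite integral_indic// muh// integral_mkcond; apply: eq_integral => x _.
  by rewrite epatch_indic muleC.
- move=> c f c0 mf f0 ih.
  have {}c0 : 0 <= c%:E by rewrite lee_fin.
  under [RHS]eq_integral do rewrite -muleA.
  rewrite (ge0_integralZl mu mD (mfX _ mf) (fun w _ => f0 _) c0) ih ge0_integralZl//.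
  + exact: emeasurable_funM.
  + by move=> x _; rewrite mule_ge0.
- move=> f g mf mg f0 g0 ihf ihg.
  under [RHS]eq_integral do rewrite /= ge0_muleDl//.
  rewrite (ge0_integralD mu mD (fun w _ => f0 _) (mfX _ mf) (fun w _ => g0 _) (mfX _ mg)) ihf ihg.
  rewrite ge0_integralD//.
  + by move=> x _; rewrite mule_ge0.
  + exact: emeasurable_funM.
  + by move=> x _; rewrite mule_ge0.
  + exact: emeasurable_funM.
- move=> f_ mf f0 ndf ih.
  rewrite (monotone_convergence mu mD (fun n => mfX _ (mf n)))//.
  transitivity (\int[nu]_x limn (fun n => f_ n x * h x)).
    rewrite monotone_convergence//.
    + by congr (limn _); apply/funext => n; exact: ih.
    + by move=> n; exact: emeasurable_funM.
    + by move=> n x _; rewrite mule_ge0.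
    + by move=> x _ m n mn; rewrite lee_wpmul2r// ndf.
  apply: eq_integral => x _.
  have cf : cvgn (f_ ^~ x) by exact: ereal_nondecreasing_is_cvgn.
  (* Multiplication by [h x] commutes with the limit even when [h x] is infinite: a zero limit
     forces every [f_ n x] to be 0, and a positive limit makes the products eventually infinite. *)
  have [hxfin|] := boolP (h x \is a fin_num).
    by apply/cvg_lim => //; exact: cvgeZr.
  rewrite fin_numE negb_and !negbK => /orP[/eqP hx|/eqP hx].
    by have := h0 x; rewrite hx.
  rewrite hx; have [l0|l0] := eqVneq (limn (f_ ^~ x)) 0.
    rewrite l0 mul0e; apply: lim_near_cst => //; apply: nearW => n.
    have -> : f_ n x = 0.
      apply/eqP; rewrite eq_le f0 andbT -l0.
      by apply: lime_ge => //; exists n => // m nm; exact: ndf.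
    by rewrite mul0e.
  have lpos : 0 < limn (f_ ^~ x).
    by rewrite lt0e l0/=; apply: lime_ge => //; exact: nearW.
  rewrite gt0_muley//.
  have [N fN] : exists N, 0 < f_ N x.
    apply: contrapT => /forallNP nf; move: l0; apply/negP; rewrite negbK.
    apply/eqP; apply: lim_near_cst => //; apply: nearW => n.
    apply/eqP; rewrite eq_le f0 andbT leNgt; exact/negP/nf.
  apply: lim_near_cst => //; exists N => // n /= Nn.
  by rewrite gt0_muley// (lt_le_trans fN)// ndf.
Qed.

(** [markov_process] speaks of indicators of the later state only; both sides are linear and
    monotone in [f], so the property extends. *)
Lemma ge0_integral_markov d d' (E : measurableType d) (W : measurableType d')
    (R : realType) (k : R -> R -> R.-pker E ~> E) (P0 : probability E R)
    (P : probability W R) (X : R -> {RV P >-> E}) (s u : R) (B : set W) :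
  markov_process k P0 X -> (0 <= s)%R -> (s < u)%R -> past X s B ->
  measurable B ->
  forall f : E -> \bar R, measurable_fun setT f -> (forall x, 0 <= f x) ->
  \int[P]_(w in B) f (X u w) = \int[P]_(w in B) \int[k s u (X s w)]_y f y.
Proof.
move=> [_ mar] s0 su sB mB.
have mfX (f : E -> \bar R) : measurable_fun setT f ->
    measurable_fun B (fun w => f (X u w)).
  by move=> mf; apply: measurable_funTS; exact: measurableT_comp.
have mk (f : E -> \bar R) : measurable_fun setT f -> (forall x, 0 <= f x) ->
    measurable_fun B (fun w => \int[k s u (X s w)]_y f y).
  move=> mf f0; apply: measurable_funTS.
  apply: (measurableT_comp (f := fun x => \int[k s u x]_y f y)) => //.
  by apply: measurable_fun_integral_kernel => // A mA; exact: measurable_kernel.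
apply: ge0_measurable_ind.
- move=> A mA; have [_ _ /(_ B sB)] := mar s u s0 su A mA.
  move=> <-; apply: eq_integral => w _.
  rewrite integral_indic// setIT fineK// ge0_fin_numE//.
  rewrite (@le_lt_trans _ _ (k s u (X s w) setT))//.
    by apply: le_measure => //; rewrite inE.
  by rewrite prob_kernel ltry.
- move=> c f c0 mf f0 ih.
  have {}c0 : 0 <= c%:E by rewrite lee_fin.
  rewrite (ge0_integralZl P mB (mfX _ mf) (fun w _ => f0 _) c0) ih.
  rewrite -(ge0_integralZl P mB (mk _ mf f0) _ c0); last first.
    by move=> w _; exact: integral_ge0.
  by apply: eq_integral => w _; rewrite ge0_integralZl.
- move=> f g mf mg f0 g0 ihf ihg.
  rewrite (ge0_integralD P mB (fun w _ => f0 _) (mfX _ mf) (fun w _ => g0 _) (mfX _ mg)) ihf ihg.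
  rewrite -(ge0_integralD P mB _ (mk _ mf f0) _ (mk _ mg g0)).
  + by apply: eq_integral => w _; rewrite ge0_integralD.
  + by move=> w _; exact: integral_ge0.
  + by move=> w _; exact: integral_ge0.
- move=> f_ mf f0 ndf ih.
  rewrite (monotone_convergence P mB (fun n => mfX _ (mf n)))//.
  transitivity (\int[P]_(w in B)
      limn (fun n => \int[k s u (X s w)]_y f_ n y)); last first.
    apply: eq_integral => w _.
    by rewrite (monotone_convergence (k s u (X s w)) measurableT mf).
  rewrite (monotone_convergence P mB (fun n => mk _ (mf n) (f0 n))).
  + by congr (limn _); apply/funext => n; exact: ih.
  + by move=> n w _; exact: integral_ge0.
  + move=> w _ m n mn; apply: ge0_le_integral => // x _.
    exact: ndf.
Qed.

(** * Path laws of Markov processes *)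

Lemma patch_preimage (W E : Type) (R : realType) (X : W -> E) (A : set E)
    (f : E -> \bar R) :
  (fun w => f (X w)) \_ (X @^-1` A) = (fun w => (f \_ A) (X w)).
Proof.
apply/funext => w; rewrite /patch.
by have -> : (w \in X @^-1` A) = (X w \in A) by apply/idP/idP; rewrite !inE.
Qed.

Lemma sigma_process_sub_measurable d d' (W : measurableType d)
    (E : measurableType d') (R : realType) (X : R -> {mfun W >-> E}) (D : set R) :
  sigma_process X D `<=` measurable.
Proof.
apply: smallest_sub; first exact: sigma_algebra_measurable.
by move=> _ [r _ [B mB <-]]; exact: measurable_funP.
Qed.

Lemma subset_sigma_process d d' (W : measurableType d)
    (E : measurableType d') (R : realType) (X : R -> {mfun W >-> E}) (D D' : set R) :
  D `<=` D' -> sigma_process X D `<=` sigma_process X D'.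
Proof.
move=> DD'; apply: sub_sigma_algebra2 => B [r Dr XB]; exists r => //; exact: DD'.
Qed.

Lemma sigma_process_preimage d d' (W : measurableType d)
    (E : measurableType d') (R : realType) (X : R -> {mfun W >-> E}) (D : set R)
    (r : R) (A : set E) :
  D r -> measurable A -> sigma_process X D (X r @^-1` A).
Proof.
move=> Dr mA; apply: sub_sigma_algebra; exists r => //.
by exists A => //; rewrite setTI.
Qed.

Section cylinder_probability.
Context d (E : measurableType d) (R : realType) (k : R -> R -> R.-pker E ~> E).
Variable A : R -> set E.
Hypothesis mA : forall u, measurable (A u).

(** For [l] increasing and above [s], this is the finite-dimensional probability of being in [A u]
    at every [u] in [l] when starting from [x] at time [s]. It depends on the transitions alone,
    hence is common to both processes. *)
Fixpoint cylinder_prob (s : R) (l : seq R) (x : E) : \bar R :=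
  if l is u :: l' then \int[k s u x]_(y in A u) cylinder_prob u l' y else 1.

Lemma cylinder_prob_ge0 s l x : 0 <= cylinder_prob s l x.
Proof. by elim: l s x => //= u l ih s x; exact: integral_ge0. Qed.

Lemma measurable_cylinder_prob s l : measurable_fun setT (cylinder_prob s l).
Proof.
elim: l s => [|u l ih] s /=; first exact: measurable_cst.
under eq_fun do rewrite integral_mkcond.
apply: measurable_fun_integral_kernel.
- by move=> B mB; exact: measurable_kernel.
- by move=> x; apply: erestrict_ge0 => y _; exact: cylinder_prob_ge0.
- by apply/(measurable_restrictT _ _).1 => //; exact: measurable_funTS.
Qed.

(** The event [B] is arbitrary so that the induction can move time forward: the first constraint is
    absorbed into the past, [B] becoming an event of the past of [u], and the Markov property
    between [s] and [u] then integrates that constraint out. *)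
Lemma markov_cylinder d' (W : measurableType d') (P0 : probability E R)
    (P : probability W R) (X : R -> {RV P >-> E}) (s : R) (l : seq R) (B : set W) :
  markov_process k P0 X -> (0 <= s)%R -> path <%R%R s l -> past X s B ->
  P (B `&` [set w | forall u, u \in l -> A u (X u w)]) =
  \int[P]_(w in B) cylinder_prob s l (X s w).
Proof.
move=> mar; elim: l s B => [|u l ih] s B s0 /=.
  move=> _ sB; have mB := sigma_process_sub_measurable sB.
  rewrite (_ : [set w | _] = setT); last by apply/seteqP; split.
  by rewrite setIT integral_cst// mul1e.
move=> /andP[su pl] sB; have mB := sigma_process_sub_measurable sB.
have u0 : (0 <= u)%R by rewrite (le_trans s0)// ltW.
pose B' := B `&` X u @^-1` A u.
have uB' : past X u B'.
  apply: (@measurableI _ (g_sigma_algebraType (\bigcup_(r in [set r | (0 <= r <= u)%R])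
    preimage_set_system setT (X r) measurable))).
    apply: subset_sigma_process sB => r /= /andP[-> rs].
    by rewrite (le_trans rs)// ltW.
  by apply: sigma_process_preimage => //=; rewrite u0 lexx.
rewrite (_ : B `&` _ = B' `&` [set w | forall v, v \in l -> A v (X v w)]); last first.
  apply/seteqP; split => w /=.
    move=> [Bw Aw]; split; first by split => //; apply: Aw; rewrite mem_head.
    by move=> v vl; apply: Aw; rewrite inE vl orbT.
  move=> [[Bw Auw] Aw]; split => // v; rewrite inE => /orP[/eqP ->//|]; exact: Aw.
rewrite (ih _ _ u0 pl uB') integral_mkcondr.
transitivity (\int[P]_(w in B) ((cylinder_prob u l) \_ (A u)) (X u w)).
  by rewrite patch_preimage.
rewrite (ge0_integral_markov mar s0 su sB mB).
- by apply: eq_integral => w _; rewrite [RHS]integral_mkcond.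
- apply/(measurable_restrictT _ _).1 => //.
  by apply: measurable_funTS; exact: measurable_cylinder_prob.
- by move=> x; apply: erestrict_ge0 => y _; exact: cylinder_prob_ge0.
Qed.

End cylinder_probability.

(** * Nonnegative densities and reweighted image measures *)

Lemma measurable_density d (E : measurableType d) (R : realType)
    (p q : probability E R) : p `<< q -> measurable_fun setT (density p q).
Proof.
move=> pq; apply: measurable_maxr => //.
exact: measurableT_comp.
Qed.

Lemma density_ge0 d (E : measurableType d) (R : realType)
    (p q : probability E R) x : (0 <= density p q x)%R.
Proof. by rewrite /density le_max lexx. Qed.

(** Truncating at 0 is harmless: the derivative coincides almost everywhere with a version that is
    finite and nonnegative. *)
Lemma integral_density d (E : measurableType d) (R : realType)
    (p q : probability E R) (A : set E) : p `<< q -> measurable A ->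
  \int[q]_(x in A) (density p q x)%:E = p A.
Proof.
move=> pq mA; rewrite (Radon_Nikodym_SigmaFinite.f_integral pq mA).
apply: ae_eq_integral => //.
- by apply/measurable_EFinP; apply: measurable_funTS; exact: measurable_density.
- apply: measurable_funTS.
  exact: measurable_int (Radon_Nikodym_SigmaFinite.f_integrable pq).
have := ae_eq_Radon_Nikodym_SigmaFinite pq mA.
apply: filterS => x /[apply] e; rewrite /density -e.
have := Radon_Nikodym_SigmaFinite.f_ge0 pq x.
have := Radon_Nikodym_SigmaFinite.f_fin_num pq x.
by case: Radon_Nikodym_SigmaFinite.f => //= r _; rewrite lee_fin => /max_idPr ->.
Qed.

Section pushforward_density.
Context d d' (W : measurableType d) (Y : measurableType d') (R : realType).
Variables (mu : {measure set W -> \bar R}) (phi : {mfun W >-> Y}).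
Variables (f : W -> \bar R).
Hypotheses (mf : measurable_fun setT f) (f0 : forall w, 0 <= f w).

(* The proofs are arguments so that the measure instance below can be inferred. *)
Definition pushforward_density (mf : measurable_fun setT f)
    (f0 : forall w, 0 <= f w) (C : set Y) :=
  \int[mu]_(w in phi @^-1` C) f w.

Local Notation nu := (pushforward_density mf f0).

Let nu_set0 : nu set0 = 0.
Proof. by rewrite /pushforward_density preimage_set0 integral_set0. Qed.

Let nu_ge0 C : 0 <= nu C. Proof. exact: integral_ge0. Qed.

Let nu_sigma_additive : semi_sigma_additive nu.
Proof.
move=> F mF tF mUF; rewrite /pushforward_density preimage_bigcup.
apply: (semi_sigma_additive_nng_induced mf f0 (F := fun n => phi @^-1` F n)).
- by move=> n; exact: measurable_funPTI.
- apply/trivIsetP => i j _ _ ij; rewrite -preimage_setI.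
  by move/trivIsetP : tF => ->//; rewrite preimage_set0.
- by apply: bigcup_measurable => n _; exact: measurable_funPTI.
Qed.

HB.instance Definition _ := isMeasure.Build _ _ _ nu
  nu_set0 nu_ge0 nu_sigma_additive.

End pushforward_density.

(** * Finite cylinders and the law of the path *)

Section path_law.
Context d (E : measurableType d) (R : realType) (t : R).

(** Times of [l] below [t] impose no constraint, so plain lists of reals and families of sets on all
    of [R] can be used in place of lists over the subtype of times. *)
Definition finite_cylinder (l : seq R) (A : R -> set E) : set (path_space E t) :=
  [set x | forall i : {r : R | (t <= r)%R}, sval i \in l -> A (sval i) (x i)].

Definition finite_cylinders : set (set (path_space E t)) :=
  [set C | exists l A, (forall u, measurable (A u)) /\ C = finite_cylinder l A].

Lemma cylinder_sub_finite : @cylinder _ E R t `<=` finite_cylinders.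
Proof.
move=> _ [i _ [B mB <-]]; exists [:: sval i], (fun=> B); split => //.
apply/seteqP; split => x /=.
  by move=> [_ Bx] j; rewrite inE => /eqP /val_inj ->.
by move=> xB; split => //; apply: xB; rewrite mem_head.
Qed.

Lemma finite_cylinders_measurable : finite_cylinders `<=` measurable.
Proof.
move=> _ [l [A [mA ->]]].
elim: l => [|u l ih].
  by rewrite (_ : finite_cylinder _ _ = setT)//; apply/seteqP; split.
have -> : finite_cylinder (u :: l) A =
    finite_cylinder [:: u] A `&` finite_cylinder l A.
  apply/seteqP; split => x /=.
    move=> xA; split => j jl; apply: xA; rewrite inE.
      by rewrite inE in jl; rewrite jl.
    by rewrite jl orbT.
  move=> [xu xl] j; rewrite inE => /orP[ju|]; last exact: xl.
  by apply: xu; rewrite inE.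
apply: measurableI => //.
have [tu|tu] := boolP (t <= u)%R; last first.
  rewrite (_ : finite_cylinder _ _ = setT)//; apply/seteqP; split => // x _ [j tj] /=.
  by rewrite inE => /eqP ju; move: tu; rewrite -ju tj.
apply: sub_sigma_algebra; exists (exist _ u tu) => //; exists (A u) => //.
apply/seteqP; split => x /=.
  move=> [_ Ax] j; rewrite inE => /eqP ju.
  have -> : j = exist _ u tu by exact: val_inj.
  by [].
by move=> xA; split => //; apply: (xA (exist _ u tu)); rewrite inE.
Qed.

Lemma finite_cylinders_setI : setI_closed finite_cylinders.
Proof.
move=> _ _ [l [A [mA ->]]] [l' [A' [mA' ->]]].
exists (l ++ l'), (fun u => (if u \in l then A u else setT) `&`
                            (if u \in l' then A' u else setT)); split.
  by move=> u; apply: measurableI; case: ifP.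
apply/seteqP; split => x /=.
  move=> [xl xl'] i _; split; case: ifPn => //; [exact: xl|exact: xl'].
move=> xA; split => i il.
  by have [] := xA i; rewrite ?mem_cat il.
by have := xA i; rewrite mem_cat il orbT => /(_ isT)[].
Qed.

Lemma finite_cylinders_setT : finite_cylinders setT.
Proof.
exists [::], (fun=> setT); split => //.
by apply/seteqP; split.
Qed.

(** Brings a cylinder into the form that [markov_cylinder] accepts: the constraint at [t], where the
    density is evaluated, is separated from the later ones, whose times are made strictly increasing
    by removing duplicates and sorting. *)
Lemma path_from_finite_cylinder d' (W : measurableType d') (X : R -> {mfun W >-> E})
    (l : seq R) (A : R -> set E) :
  path_from X t @^-1` finite_cylinder l A =
  X t @^-1` (if t \in l then A t else setT) `&`
  [set w | forall u, u \in sort <=%R%R [seq u <- undup l | (t < u)%R] -> A u (X u w)].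
Proof.
apply/seteqP; split => w /=.
  move=> xA; split.
    case: ifPn => // tl.
    by apply: (xA (exist _ t (lexx t))).
  move=> u; rewrite mem_sort mem_filter mem_undup => /andP[tu ul].
  by apply: (xA (exist _ u (ltW tu))).
move=> [xt xA] [u tu] /= ul; have := tu; rewrite le_eqVlt => /predU1P[tu'|tu'].
  by subst u; move: xt; rewrite ul.
by apply: xA; rewrite mem_sort mem_filter mem_undup tu'.
Qed.

End path_law.

(** On a cylinder both sides equal the [q]-integral over [A0] of the product of [density p q] and
    [h], where [h] is the transition probability of the constraints after [t]. Under [PP] the
    density comes from [p]; under [PQ] the factor [h] comes from the Markov property. *)
Lemma path_law_density d dP dQ (R : realType) (E : measurableType d)
    (WP : measurableType dP) (WQ : measurableType dQ)
    (k : R -> R -> R.-pker E ~> E) (P0 Q0 : probability E R)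
    (PP : probability WP R) (PQ : probability WQ R)
    (XP : R -> {RV PP >-> E}) (XQ : R -> {RV PQ >-> E}) (t : R)
    (p q : probability E R) (C : set (path_space E t)) :
  markov_process k P0 XP -> markov_process k Q0 XQ -> (0 <= t)%R ->
  (forall A, measurable A -> PP (XP t @^-1` A) = p A) ->
  (forall A, measurable A -> PQ (XQ t @^-1` A) = q A) ->
  p `<< q -> measurable C ->
  PP (path_from XP t @^-1` C) =
  \int[PQ]_(w in path_from XQ t @^-1` C) (density p q (XQ t w))%:E.
Proof.
move=> mP mQ t0 Pp Qq pq mC.
have md := measurable_density pq.
have mZ : measurable_fun setT (fun w => (density p q (XQ t w))%:E).
  by apply/measurable_EFinP; exact: measurableT_comp.
have Z0 w : 0 <= (density p q (XQ t w))%:E by rewrite lee_fin density_ge0.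
pose m1 : {measure set (path_space E t) -> \bar R} :=
  distribution PP (path_from XP t).
pose m2 : {measure set (path_space E t) -> \bar R} :=
  pushforward_density PQ (path_from XQ t) mZ Z0.
suff : m1 C = m2 C by [].
apply: (g_sigma_algebra_measure_unique (@finite_cylinders _ E R t)
  (@finite_cylinders_measurable _ E R t) (fun=> setT)).
- by move=> _; exact: finite_cylinders_setT.
- by rewrite bigcup_const//; exists 0%N.
- exact: finite_cylinders_setI.
- move=> _ [l [A [mA ->]]]; rewrite /m1 /m2 /= /distribution /pushforward.
  rewrite /pushforward_density !path_from_finite_cylinder.
  set A0 := if _ then _ else _; set l' := sort _ _.
  have mA0 : measurable A0 by rewrite /A0; case: ifP.
  have pl' : path <%R%R t l'.
    rewrite path_sortedE; last exact: lt_trans.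
    rewrite sort_lt_sorted filter_uniq ?undup_uniq// andbT.
    by apply/allP => u; rewrite mem_sort mem_filter => /andP[].
  set h := cylinder_prob k A t l'.
  have mh : measurable_fun setT h by exact: measurable_cylinder_prob.
  have h0 x : 0 <= h x by exact: cylinder_prob_ge0.
  have pastX dW (W : measurableType dW) (P : probability W R) (X : R -> {RV P >-> E}) B :
      measurable B -> past X t (X t @^-1` B).
    by move=> mB; apply: sigma_process_preimage => //=; rewrite t0 lexx.
  have mXQ : measurable_fun setT (XQ t) by [].
  have mXP : measurable_fun setT (XP t) by [].
  rewrite (markov_cylinder mA mP t0 pl')//; last exact: pastX.
  have mD : measurable [set w | forall u, u \in l' -> A u (XQ u w)].
    rewrite (_ : [set w | _] = \bigcap_(u in [set` l']) XQ u @^-1` A u)//.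
    apply: fin_bigcap_measurable; first exact: finite_seq.
    by move=> u _; exact: measurable_funPTI.
  rewrite -/h [LHS]integral_mkcond.
  transitivity (\int[PP]_w (h \_ A0) (XP t w)).
    by rewrite patch_preimage.
  have mhA : measurable_fun setT (h \_ A0).
    by apply/(measurable_restrictT _ _).1 => //; exact: measurable_funTS.
  have hA0 x : 0 <= (h \_ A0) x by apply: erestrict_ge0 => y _; exact: h0.
  rewrite (ge0_integral_comp_density (nu := q) (h := EFin \o density p q) mXP)//.
  + rewrite setIC integral_mkcondr.
    transitivity (\int[PQ]_(w in [set w | forall u, u \in l' -> A u (XQ u w)])
      ((EFin \o density p q) \_ A0) (XQ t w)).
      (* The roles are exchanged here: the density is the integrand, and [h] is the density with
         respect to [q] of the law of [XQ t] restricted to the event of later constraints. *)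
      rewrite (ge0_integral_comp_density (nu := q) (h := h) mXQ)//.
      * apply: eq_integral => x _; rewrite /patch; case: ifP => _.
          by rewrite muleC.
        by rewrite !mul0e.
      * move=> B mB.
        transitivity (\int[PQ]_(w in XQ t @^-1` B) h (XQ t w)).
          exact: (markov_cylinder mA mQ t0 pl' (pastX _ _ _ _ _ mB)).
        rewrite [LHS]integral_mkcond [RHS]integral_mkcond.
        transitivity (\int[PQ]_w (h \_ B) (XQ t w)).
          by rewrite patch_preimage.
        rewrite (ge0_integral_comp_density (nu := q) (h := cst 1) mXQ)//.
        - by apply: eq_integral => x _; rewrite mule1.
        - by move=> B' mB'; rewrite setIT integral_cst// mul1e; exact: Qq.
        - by apply/(measurable_restrictT _ _).1 => //; exact: measurable_funTS.
        - by move=> x; apply: erestrict_ge0 => y _; exact: h0.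
      * apply/(measurable_restrictT _ _).1 => //.
        by apply: measurable_funTS; exact/measurable_EFinP.
      * by move=> x; apply: erestrict_ge0 => y _; rewrite lee_fin density_ge0.
    by rewrite -(patch_preimage (XQ t) A0 (EFin \o density p q)).
  + exact/measurable_EFinP.
  + by move=> x; rewrite lee_fin density_ge0.
  + by move=> B mB; rewrite setIT integral_density//; exact: Pp.
- by move=> _; rewrite /m1 /= probability_setT ltry.
- by apply: sub_sigma_algebra2 mC; exact: cylinder_sub_finite.
Qed.

(** Preimages under the path map form a sigma-field containing the generators of [future X s].
    Integrals over future events thus become integrals over path events, which the reweighting
    formula evaluates. *)
Lemma future_preimage d d' (W : measurableType d) (E : measurableType d')
    (R : realType) (X : R -> {mfun W >-> E}) (s : R) (B : set W) :
  future X s B ->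
  exists2 C : set (path_space E s), measurable C & B = path_from X s @^-1` C.
Proof.
have : future X s `<=` preimage_set_system setT (path_from X s) measurable.
  apply: smallest_sub.
    apply: sigma_algebra_preimage; exact: sigma_algebra_measurable.
  move=> _ [r /= sr [A mA <-]].
  exists ((fun x : path_space E s => x (exist _ r sr)) @^-1` A).
    apply: sub_sigma_algebra; exists (exist _ r sr) => //; exists A => //.
    by rewrite setTI.
  by rewrite !setTI.
by move=> /[apply] -[C mC <-]; exists C => //; rewrite setTI.
Qed.

Section path_restriction.
Context d (E : measurableType d) (R : realType) (r s : R) (rs : (r <= s)%R).

Definition path_restriction (x : path_space E r) : path_space E s :=
  fun i => x (exist _ (sval i) (le_trans rs (svalP i))).

Lemma measurable_path_restriction : measurable_fun setT path_restriction.
Proof.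
apply: (@measurability _ _ _ _ setT path_restriction (@cylinder _ E R s)) => //.
move=> _ [_ [i _ [B mB <-]] <-]; rewrite !setTI.
apply: sub_sigma_algebra.
exists (exist _ (sval i) (le_trans rs (svalP i))) => //.
by exists B => //; rewrite setTI.
Qed.

End path_restriction.

Lemma future_backward_filtration d d' (W : measurableType d) (E : measurableType d')
    (R : realType) (X : R -> {mfun W >-> E}) (t : R) :
  backward_filtration t (future X).
Proof.
split=> [s _|r s _ rs].
  split; first exact: smallest_sigma_algebra.
  exact: sigma_process_sub_measurable.
by apply: subset_sigma_process => u /=; exact: le_trans.
Qed.

(** * The density process as a backward martingale *)

Section density_process.
Context (R : realType) (d dP dQ : measure_display)
    (E : measurableType d) (WP : measurableType dP) (WQ : measurableType dQ)
    (k : R -> R -> R.-pker E ~> E) (P0 Q0 : probability E R)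
    (PP : probability WP R) (PQ : probability WQ R)
    (XP : R -> {RV PP >-> E}) (XQ : R -> {RV PQ >-> E}).
Hypotheses (mP : markov_process k P0 XP) (mQ : markov_process k Q0 XQ).

Let P_ s : probability E R := distribution PP (XP s).
Let Q_ s : probability E R := distribution PQ (XQ s).
Let Z s w := density (P_ s) (Q_ s) (XQ s w).

Lemma path_lawE t (C : set (path_space E t)) : (0 <= t)%R -> P_ t `<< Q_ t ->
  measurable C ->
  PP (path_from XP t @^-1` C) = \int[PQ]_(w in path_from XQ t @^-1` C) (Z t w)%:E.
Proof. by move=> t0 pq mC; exact: (path_law_density (p := P_ t) (q := Q_ t) mP mQ). Qed.

Lemma measurable_density_process t : P_ t `<< Q_ t -> measurable_fun setT (Z t).
Proof. by move=> pq; apply: measurableT_comp => //; exact: measurable_density. Qed.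

Lemma path_law_dominates t : (0 <= t)%R -> P_ t `<< Q_ t ->
  distribution PP (path_from XP t) `<< distribution PQ (path_from XQ t).
Proof.
move=> t0 pq; apply/null_content_dominatesP => C mC QC0.
rewrite [LHS](path_lawE t0 pq mC).
have mXC : measurable (path_from XQ t @^-1` C).
  by rewrite -[X in measurable X]setTI; apply: measurable_funP.
apply: null_set_integral => //.
by apply: measurable_funTS; apply/measurable_EFinP; exact: measurable_density_process.
Qed.

Lemma marginal_dominates t s : (0 <= t)%R -> (t <= s)%R ->
  P_ t `<< Q_ t -> P_ s `<< Q_ s.
Proof.
move=> t0 ts pq; apply/null_content_dominatesP => A mA QA0.
have /null_content_dominatesP dom := path_law_dominates t0 pq.
pose C : set (path_space E t) := (fun x => x (exist _ s ts)) @^-1` A.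
have mC : measurable C.
  apply: sub_sigma_algebra; exists (exist _ s ts) => //; exists A => //.
  by rewrite setTI.
exact: (dom C mC QA0).
Qed.

Lemma density_process_sub_measurable s : P_ s `<< Q_ s ->
  sub_measurable (future XQ s) (Z s).
Proof.
move=> pq _ [A mA <-]; rewrite setTI.
apply: (sigma_process_preimage (A := density (P_ s) (Q_ s) @^-1` A)) => //=.
rewrite -[X in measurable X]setTI.
exact: measurable_density.
Qed.

Lemma integral_density_process s : P_ s `<< Q_ s ->
  \int[PQ]_w (Z s w)%:E = 1.
Proof.
move=> pq; have md := measurable_density pq.
transitivity (\int[Q_ s]_x (density (P_ s) (Q_ s) x)%:E).
  rewrite ge0_integral_distribution//.
    exact/measurable_EFinP.
  by move=> y; rewrite lee_fin density_ge0.
by rewrite integral_density// probability_setT.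
Qed.

Lemma density_process_integrable s : P_ s `<< Q_ s ->
  PQ.-integrable setT (EFin \o Z s).
Proof.
move=> pq; apply/integrableP; split.
  by apply/measurable_EFinP; exact: measurable_density_process.
under eq_integral do rewrite /= ger0_norm ?density_ge0//.
by rewrite (integral_density_process pq) ltry.
Qed.

(** Over an event of [future XQ s], the integrals of [Z r] and of [Z s] are both the probability of
    one and the same path event for [XP]. *)
Lemma density_process_cond_exp r s : (0 <= r)%R -> (r <= s)%R ->
  P_ r `<< Q_ r -> is_cond_exp PQ (future XQ s) (Z r) (Z s).
Proof.
move=> r0 rs pq; have pqs := marginal_dominates r0 rs pq.
split.
- exact: density_process_sub_measurable.
- exact: density_process_integrable.
move=> _ /future_preimage[C mC ->].
rewrite -(path_lawE (le_trans r0 rs) pqs mC).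
have mC' : measurable (path_restriction rs @^-1` C).
  by rewrite -[X in measurable X]setTI; exact: measurable_path_restriction.
(* Restricting the path from [r] to the times after [s] gives the path from [s] by computation, so
   both path events are already convertible. *)
exact: (path_lawE r0 pq mC').
Qed.

Lemma density_process_backward_martingale t : (0 <= t)%R -> P_ t `<< Q_ t ->
  backward_martingale PQ t (future XQ) Z.
Proof.
move=> t0 pq; split.
  split; first exact: future_backward_filtration.
  move=> s ts; have pqs := marginal_dominates t0 ts pq.
  split; first exact: density_process_sub_measurable.
  exact: density_process_integrable.
move=> r s tr rs; exists (Z s).
  apply: density_process_cond_exp => //; first exact: le_trans tr.
  exact: marginal_dominates tr pq.
exact: aeW.
Qed.

End density_process.

(** * Convex functions on the half-line *)

Section convex_ge0.
Context (R : realType).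
Implicit Types (U : R -> R) (x y z : R).
Local Open Scope ring_scope.

(** Convexity with plain real weights, a form suited to direct field and linear arithmetic. *)
Definition convex_ge0 U := forall x y l, 0 <= x -> 0 <= y -> 0 <= l -> l <= 1 ->
  U (l * x + (1 - l) * y) <= l * U x + (1 - l) * U y.

Lemma convex_function_ge0 U :
  @convex_function R R^o [set x : R | 0 <= x] U -> convex_ge0 U.
Proof.
move=> cU x y l x0 y0 l0 l1.
have l01 : 0 <= l <= 1 by rewrite l0 l1.
have := @cU (Itv01 l0 l1) x y.
by rewrite !inE => /(_ x0 y0).
Qed.

Lemma convex_ge0_three_points U x y z : convex_ge0 U ->
  0 <= x -> x < z -> z < y -> (y - x) * U z <= (y - z) * U x + (z - x) * U y.
Proof.
move=> cU x0 xz zy.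
have xy : 0 < y - x by rewrite subr_gt0 (lt_trans xz).
have y0 : 0 <= y by rewrite (le_trans x0)// ltW// (lt_trans xz).
have l0 : 0 <= (y - z) / (y - x) by rewrite divr_ge0// ltW// subr_gt0.
have l1 : (y - z) / (y - x) <= 1 by rewrite ler_pdivrMr// mul1r lerB// ltW.
have /= := cU x y _ x0 y0 l0 l1.
have -> : (y - z) / (y - x) * x + (1 - (y - z) / (y - x)) * y = z.
  by field; rewrite gt_eqF.
move=> h; rewrite -(ler_pM2l xy) in h; apply: (le_trans h).
rewrite le_eqVlt; apply/orP; left; apply/eqP.
by field; rewrite gt_eqF.
Qed.

(** The slope is the supremum of the slopes of chords to the left of [z], bounded by every chord
    slope to the right. Positivity of [z] provides left chords; at 0 a supporting line may fail to
    exist. *)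
Lemma convex_ge0_support U z : convex_ge0 U -> 0 < z ->
  exists a, forall y, 0 <= y -> U z + a * (y - z) <= U y.
Proof.
move=> cU z0; pose S := [set (U z - U x) / (z - x) | x in [set x | 0 <= x < z]].
have S0 : S !=set0 by exists ((U z - U 0) / (z - 0)), 0 => //=; rewrite lexx.
have Sub y : z < y -> ubound S ((U y - U z) / (y - z)).
  move=> zy _ [x /= /andP[x0 xz] <-].
  rewrite ler_pdivrMr ?subr_gt0// mulrAC ler_pdivlMr ?subr_gt0//.
  by have := convex_ge0_three_points cU x0 xz zy; lra.
have Shas : has_sup S.
  split => //; exists ((U (z + 1) - U z) / (z + 1 - z)); apply: Sub.
  by rewrite ltrDl.
exists (sup S) => y y0; have [yz|zy|->] := ltgtP y z; last by rewrite subrr mulr0 addr0.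
- have : (U z - U y) / (z - y) <= sup S.
    by apply: sup_upper_bound => //; exists y => //=; rewrite y0.
  by rewrite ler_pdivrMr ?subr_gt0//; lra.
- have : sup S <= (U y - U z) / (y - z) by apply: ge_sup => //; exact: Sub.
  by rewrite ler_pdivlMr ?subr_gt0//; lra.
Qed.

(* Lowering slope and intercept of an affine minorant on [0, +oo[ preserves
   minoration, so supporting lines may be perturbed to rational ones. *)
Lemma convex_ge0_rat_minorant U z e : convex_ge0 U -> 0 < z -> 0 < e ->
  exists a b : rat, (forall y, 0 <= y -> ratr a * y + ratr b <= U y) /\
    U z - e < ratr a * z + ratr b.
Proof.
move=> cU z0 e0; have [al sup] := convex_ge0_support cU z0.
(* The error [e] is split in halves: lowering the slope by this amount costs at most [e / 2] at [z]
   since [z / (z + 1) <= 1], and lowering the intercept costs less than [e / 2]. *)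
have d0 : 0 < e / (2 * (z + 1)) by rewrite divr_gt0// mulr_gt0// addr_gt0.
have [a] := @rat_in_itvoo _ (al - e / (2 * (z + 1))) al (ltac:(by rewrite ltrBlDr ltrDl)).
rewrite in_itv/= => /andP[a1 a2].
have e2 : 0 < e / 2 by rewrite divr_gt0.
have [b] := @rat_in_itvoo _ (U z - al * z - e / 2) (U z - al * z)
  (ltac:(by rewrite ltrBlDr ltrDl)).
rewrite in_itv/= => /andP[b1 b2].
exists a, b; split.
  move=> y y0; apply: le_trans (sup y y0).
  have : ratr a * y <= al * y by rewrite ler_wpM2r// ltW.
  by lra.
have h : (al - e / (2 * (z + 1))) * z <= ratr a * z by rewrite ler_wpM2r// ltW.
have h2 : e / (2 * (z + 1)) * z <= e / 2.
  rewrite invfM mulrA -[leRHS]mulr1 -mulrA ler_wpM2l//; first exact: ltW.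
  by rewrite mulrC ler_pdivrMr ?addr_gt0// mul1r lerDl.
by lra.
Qed.

(** Near [z] the graph lies below the chords from [z] to 0 and to [2 * z]. The weight [l] of the far
    endpoint is [|y - z| / z], and [C] bounds the variation of [U] along both chords. *)
Lemma convex_ge0_usc U z e : convex_ge0 U -> 0 < z -> 0 < e ->
  exists2 d, 0 < d & forall y, 0 <= y -> `|y - z| < d -> U y <= U z + e.
Proof.
move=> cU z0 e0.
pose C := `|U 0 - U z| + `|U (2 * z) - U z| + 1.
have C0 : 0 < C by rewrite ltr_wpDl// addr_ge0.
exists (Num.min z (z * e / C)); first by rewrite lt_min z0/= divr_gt0// mulr_gt0.
move=> y y0; rewrite lt_min => /andP[yz ye].
pose l := `|y - z| / z.
have l0 : 0 <= l by rewrite divr_ge0// ltW.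
have l1 : l <= 1 by rewrite ler_pdivrMr// mul1r ltW.
have lC : l * C <= e.
  by rewrite /l mulrAC ler_pdivrMr// (mulrC e); apply: ltW; rewrite -ltr_pdivlMr.
have lub u : u <= C -> l * u <= e.
  by move=> uC; apply: le_trans lC; rewrite ler_wpM2l.
have [yz'|zy] := leP y z.
- have : U (l * 0 + (1 - l) * z) <= l * U 0 + (1 - l) * U z by apply: cU => //; exact: ltW.
  have -> : l * 0 + (1 - l) * z = y.
    by rewrite /l ler0_norm ?subr_le0//; field; rewrite gt_eqF.
  have : l * (U 0 - U z) <= e.
    by apply: lub; have := ler_norm (U 0 - U z); rewrite /C; have := normr_ge0 (U (2 * z) - U z); lra.
  by lra.
- have z2 : 0 <= 2 * z by rewrite mulr_ge0// ltW.
  have : U (l * (2 * z) + (1 - l) * z) <= l * U (2 * z) + (1 - l) * U z.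
    by apply: cU => //; exact: ltW.
  have -> : l * (2 * z) + (1 - l) * z = y.
    by rewrite /l gtr0_norm ?subr_gt0//; field; rewrite gt_eqF.
  have : l * (U (2 * z) - U z) <= e.
    by apply: lub; have := ler_norm (U (2 * z) - U z); rewrite /C; have := normr_ge0 (U 0 - U z); lra.
  by lra.
Qed.

(** Sublevel sets are intervals. Composing with [Num.max 0] gives a function on all of [R] that sees
    only the values of [U] on the half-line. *)
Lemma measurable_convex_ge0 U : convex_ge0 U ->
  measurable_fun setT (fun x : R => U (Num.max 0 x)).
Proof.
move=> cU; apply: (measurability _ (RGenOInfty.measurableE R)).
move=> _ [_ [c ->] <-]; rewrite setTI.
rewrite (_ : _ @^-1` _ = ~` [set x | U (Num.max 0 x) <= c]); last first.
  apply/seteqP; split => x /=; rewrite in_itv/= andbT ltNge; first by move/negP.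
  by move/negP.
apply: measurableC; apply: is_interval_measurable => x y /= Ux Uy z /andP[xz zy].
have [z0|z0] := leP z 0.
  by rewrite (max_idPl (le_trans xz z0)) in Ux.
have zy0 : z <= Num.max 0 y by rewrite le_max zy orbT.
have xz0 : Num.max 0 x <= z by rewrite ge_max xz ltW.
move: xz0; rewrite le_eqVlt => /predU1P[<-//|xz0].
move: zy0; rewrite le_eqVlt => /predU1P[->//|zy0].
have x0 : 0 <= Num.max 0 x by rewrite le_max lexx.
have := convex_ge0_three_points cU x0 xz0 zy0.
have xy0 := lt_trans xz0 zy0.
move=> h; rewrite -(@ler_pM2l _ (Num.max 0 y - Num.max 0 x)) ?subr_gt0//.
apply: (le_trans h).
have : (Num.max 0 y - z) * U (Num.max 0 x) <= (Num.max 0 y - z) * c.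
  by rewrite ler_wpM2l// subr_ge0 ltW.
have : (z - Num.max 0 x) * U (Num.max 0 y) <= (z - Num.max 0 x) * c.
  by rewrite ler_wpM2l// subr_ge0 ltW.
by lra.
Qed.

Lemma measurable_convex_comp U d (T : measurableType d) (f : T -> R) :
  convex_ge0 U -> (forall x : T, 0 <= f x) -> measurable_fun setT f ->
  measurable_fun setT (U \o f).
Proof.
move=> cU f0 mf.
rewrite (_ : U \o f = (fun x => U (Num.max 0 x)) \o f).
  by apply: measurableT_comp => //; exact: measurable_convex_ge0.
by apply/funext => x /=; rewrite (max_idPr (f0 x)).
Qed.

End convex_ge0.

(** * Conditional expectations *)

Section integral_lemmas.
Context d (W : measurableType d) (R : realType) (P : probability W R).
Implicit Types (f g : W -> R) (B : set W).

Lemma integrable_affine f (a b : R) : P.-integrable setT (EFin \o f) ->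
  P.-integrable setT (EFin \o (fun w => a * f w + b)%R).
Proof.
move=> intf.
rewrite (_ : EFin \o _ = (fun w => a%:E * (EFin \o f) w) \+ (EFin \o cst b)).
  by apply: integrableD => //; [exact: integrableZl|exact: finite_measure_integrable_cst].
by apply/funext => w /=; rewrite EFinD EFinM.
Qed.

Lemma integral_affine f (a b : R) B : P.-integrable setT (EFin \o f) ->
  measurable B ->
  \int[P]_(w in B) (a * f w + b)%:E = a%:E * \int[P]_(w in B) (f w)%:E + b%:E * P B.
Proof.
move=> intf mB.
have intfB : P.-integrable B (EFin \o f) by exact: integrableS intf.
under eq_integral do rewrite EFinD EFinM.
rewrite integralD//; last 2 first.
- exact: (integrableZl mB a intfB).
- exact: (finite_measure_integrable_cst P b mB).
by rewrite integralZl// integral_cst.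
Qed.

(** The integrands may be signed: [g] is almost everywhere [f] plus the positive part of [g - f],
    whose integral is nonnegative. *)
Lemma ae_le_integral f g B : measurable B ->
  P.-integrable setT (EFin \o f) -> P.-integrable setT (EFin \o g) ->
  {ae P, forall w, (f w <= g w)%R} ->
  \int[P]_(w in B) (f w)%:E <= \int[P]_(w in B) (g w)%:E.
Proof.
move=> mB intf intg fg.
have mf : measurable_fun setT f by exact/measurable_EFinP/(measurable_int _ intf).
have mg : measurable_fun setT g by exact/measurable_EFinP/(measurable_int _ intg).
have /integrableP[mh hoo] : P.-integrable setT (EFin \o (fun w => g w - f w)%R).
  rewrite (_ : EFin \o _ = (EFin \o g) \- (EFin \o f)); first exact: integrableB.
  by apply/funext => w /=; rewrite EFinB.
have intm : P.-integrable setT (EFin \o (fun w => Num.max 0 (g w - f w))%R).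
  apply/integrableP; split.
    by apply/measurable_EFinP; apply: measurable_maxr => //; exact/measurable_EFinP.
  apply: le_lt_trans hoo; apply: ge0_le_integral => //.
  - apply/measurable_EFinP; apply: measurableT_comp => //.
    by apply: measurable_maxr => //; exact/measurable_EFinP.
  - exact: measurableT_comp mh.
  - move=> w _; rewrite /= lee_fin; have [h|h] := leP (g w - f w)%R 0%R.
      by rewrite normr0.
    by [].
apply: (@le_trans _ _ (\int[P]_(w in B) ((f w)%:E + (Num.max 0 (g w - f w))%:E))).
  rewrite integralD//; last 2 first.
  - exact: integrableS intf.
  - exact: integrableS intm.
  by rewrite leeDl// integral_ge0// => w _; rewrite lee_fin le_max lexx.
rewrite le_eqVlt; apply/orP; left; apply/eqP; apply: ae_eq_integral => //.
- apply: measurable_funTS; apply: emeasurable_funD; first exact/measurable_EFinP.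
  exact: measurable_int intm.
- by apply: measurable_funTS; exact/measurable_EFinP.
apply: filterS fg => w fgw _ /=.
by rewrite (max_idPr _) ?subr_ge0// -EFinD addrC subrK.
Qed.

End integral_lemmas.

Lemma sigma_algebra_setT (T : Type) (G : set (set T)) :
  sigma_algebra setT G -> G setT.
Proof. by move=> [G0 /(_ _ G0) + _]; rewrite setD0. Qed.

Lemma bigcap_sigma_algebra (T I : Type) (D : set I) (G : I -> set (set T)) :
  (forall i, D i -> sigma_algebra setT (G i)) ->
  sigma_algebra setT (\bigcap_(i in D) G i).
Proof.
move=> sG; split.
- by move=> i /sG[].
- by move=> A GA i Di; have [_ + _] := sG i Di; apply; exact: GA.
- by move=> A GA i Di; have [_ _] := sG i Di; apply => n; exact: GA.
Qed.

Section conditional_expectation.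
Context d (W : measurableType d) (R : realType) (P : probability W R).
Variable G : set (set W).
Hypotheses (sG : sigma_algebra setT G) (Gm : G `<=` measurable).
Implicit Types (f g : W -> R).

Lemma sub_measurableP f :
  sub_measurable G f <-> measurable_fun setT (f : g_sigma_algebraType G -> R).
Proof.
split=> [Gf _ B mB|mf B [A mA <-]].
  by apply: sub_sigma_algebra; apply: Gf; exists B.
by rewrite -(sigma_algebra_id sG); exact: mf.
Qed.

Lemma sub_measurable_measurable f : sub_measurable G f -> measurable_fun setT f.
Proof. by move=> Gf _ B mB; apply: Gm; apply: Gf; exists B. Qed.

(** Radon-Nikodym on the sigma-field [G]: the measure with density [f] is differentiated with
    respect to [P], both restricted to [G]. The restrictions are image measures under the identity,
    seen as a map into [W] equipped with [G]. *)
Lemma cond_exp_ge0_exists f : P.-integrable setT (EFin \o f) ->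
  (forall w, (0 <= f w)%R) ->
  exists2 g, is_cond_exp P G f g & forall w, (0 <= g w)%R.
Proof.
move=> intf f0.
have mf := measurable_int _ intf.
have f0' w : 0 <= (EFin \o f) w by rewrite lee_fin.
pose T := g_sigma_algebraType G.
pose idG : W -> T := id.
have GB B : <<s G>> B -> measurable B by rewrite (sigma_algebra_id sG); exact: Gm.
have midG : measurable_fun setT idG by move=> _ B mB; rewrite setTI; exact: GB.
pose idm : {mfun W >-> T} := HB.pack idG (isMeasurableFun.Build _ _ _ _ idG midG).
pose mu : probability T R := distribution P idm.
have nufin : fin_num_fun (pushforward_density P idm mf f0').
  move=> B mB; rewrite /pushforward_density; apply: integrable_fin_num => //.
    exact: GB.
  by apply: integrableS intf => //; exact: GB.
pose nu : {finite_measure set T -> \bar R} :=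
  HB.pack (pushforward_density P idm mf f0')
    (Measure_isFinite.Build _ _ _ (pushforward_density P idm mf f0') nufin).
have numu : nu `<< mu.
  apply/null_content_dominatesP => B mB muB0.
  apply: null_set_integral => //; first exact: GB.
  exact: measurable_funTS.
pose g := Radon_Nikodym_SigmaFinite.f nu mu.
have g0 x : 0 <= g x by exact: Radon_Nikodym_SigmaFinite.f_ge0.
have gfin x : g x \is a fin_num by exact: Radon_Nikodym_SigmaFinite.f_fin_num.
have mg : measurable_fun setT g.
  exact: measurable_int (Radon_Nikodym_SigmaFinite.f_integrable numu).
have eqint B : <<s G>> B -> \int[P]_(w in B) (fine (g w))%:E = \int[P]_(w in B) (f w)%:E.
  move=> mB; under eq_integral do rewrite fineK//.
  transitivity (nu B); last by [].
  rewrite (Radon_Nikodym_SigmaFinite.f_integral numu mB).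
  apply/esym/(ge0_integral_pushforward midG) => //.
  exact: measurable_funTS.
have mfg : measurable_fun setT (fine \o g : T -> R) by exact: measurableT_comp.
have Gfg : sub_measurable G (fine \o g) by exact/sub_measurableP.
exists (fine \o g).
  split => //.
    apply/integrableP; split.
      by apply/measurable_EFinP; exact: sub_measurable_measurable.
    under eq_integral do rewrite /= ger0_norm ?fine_ge0//.
    rewrite eqint; last exact: (@measurableT _ T).
    exact: integrable_lty.
  by move=> B GBB; apply: eqint; exact: sub_sigma_algebra.
by move=> w; apply: fine_ge0.
Qed.

Lemma cond_exp_lbound_exists f c : P.-integrable setT (EFin \o f) ->
  (forall w, (c <= f w)%R) -> exists g, is_cond_exp P G f g.
Proof.
move=> intf fc.
(* The shift by [c] is written with a factor 1 to fit the affine integration lemmas. *)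
have fc0 w : (0 <= 1 * f w + - c)%R by rewrite mul1r subr_ge0.
have [g [Gg intg eg] _] := cond_exp_ge0_exists (integrable_affine 1 (- c) intf) fc0.
exists (fun w => 1 * g w + c)%R; split.
- apply/sub_measurableP; apply: measurable_funD => //.
  by apply: measurable_funM => //; exact/sub_measurableP.
- exact: integrable_affine.
- move=> B GB; have mB := Gm GB.
  rewrite integral_affine// eg// integral_affine// !mul1e -addeA EFinN mulNe.
  by rewrite [X in _ + X]addeC subee ?adde0// fin_numM// fin_num_measure.
Qed.

(** The part of [D] where [f] exceeds [g] lies in [G], so it may serve as a test event, and the
    hypothesis makes it null. Localising to [D] allows a comparison on the zero set of a conditional
    expectation. *)
Lemma ae_le_of_integral_le f g D : sub_measurable G f -> sub_measurable G g ->
  P.-integrable setT (EFin \o f) -> P.-integrable setT (EFin \o g) -> G D ->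
  (forall B, G B -> B `<=` D ->
    \int[P]_(w in B) (f w)%:E <= \int[P]_(w in B) (g w)%:E) ->
  {ae P, forall w, D w -> (f w <= g w)%R}.
Proof.
move=> /sub_measurableP Gf /sub_measurableP Gg intf intg GD fg.
pose B := D `&` (fun w => f w - g w)%R @^-1` `]0%R, +oo[%classic.
have GB : G B.
  rewrite -(sigma_algebra_id sG).
  apply: (@measurableI _ (g_sigma_algebraType G)); first exact: sub_sigma_algebra.
  rewrite -[X in measurable X]setTI.
  by apply: (measurable_funB Gf Gg) => //; exact: measurable_itv.
have mB := Gm GB.
have BD : B `<=` D by move=> w [].
have Bfg w : B w -> (0 < f w - g w)%R by move=> [_] /=; rewrite in_itv/= andbT.
have intfB : P.-integrable B (EFin \o f) by exact: integrableS intf.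
have intgB : P.-integrable B (EFin \o g) by exact: integrableS intg.
have mfg : measurable_fun B (fun w => (f w - g w)%:E).
  apply/measurable_EFinP; apply: measurable_funB; apply/measurable_EFinP.
    exact: measurable_int intfB.
  exact: measurable_int intgB.
have /(ae_eq_integral_abs P mB mfg) : \int[P]_(w in B) `|(f w - g w)%:E| = 0.
  under eq_integral => w wB.
    rewrite gee0_abs; last by rewrite lee_fin ltW// Bfg// -in_setE.
    over.
  apply/eqP; rewrite eq_le; apply/andP; split; last first.
    by apply: integral_ge0 => w Bw; rewrite lee_fin ltW// Bfg.
  under eq_integral do rewrite EFinB.
  rewrite integralB_EFin// sube_le0; exact: fg.
apply: filterS => w Bw Dw; rewrite leNgt; apply/negP => gf.
have Bw' : B w by split => //=; rewrite in_itv/= andbT subr_gt0.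
have := Bw Bw' => /= -[] /eqP; rewrite subr_eq0 => /eqP fgw.
by rewrite fgw ltxx in gf.
Qed.

Lemma cond_exp_jensen (U : R -> R) f g h : convex_ge0 U ->
  P.-integrable setT (EFin \o f) -> (forall w, (0 <= f w)%R) ->
  P.-integrable setT (EFin \o (U \o f)) ->
  is_cond_exp P G f g -> (forall w, (0 <= g w)%R) ->
  is_cond_exp P G (U \o f) h ->
  {ae P, forall w, (U (g w) <= h w)%R}.
Proof.
move=> cU intf f0 intUf [Gg intg eg] g0 [Gh inth eh].
have GT := sigma_algebra_setT sG.
have minor (ab : rat * rat) :
    (forall y, 0 <= y -> ratr ab.1 * y + ratr ab.2 <= U y)%R ->
    {ae P, forall w, (ratr ab.1 * g w + ratr ab.2 <= h w)%R}.
  move=> abU.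
  have : {ae P, forall w, setT w -> (ratr ab.1 * g w + ratr ab.2 <= h w)%R}.
    apply: ae_le_of_integral_le => //.
    - apply/sub_measurableP; apply: measurable_funD => //.
      by apply: measurable_funM => //; exact/sub_measurableP.
    - exact: integrable_affine.
    - move=> B GB _; have mB := Gm GB.
      rewrite eh// integral_affine// eg// -integral_affine//.
      apply: le_integral => //.
      + by apply: integrableS (integrable_affine _ _ intf).
      + exact: integrableS intUf.
      + by move=> w _; rewrite lee_fin; exact: abU.
  by apply: filterS => w; apply.
(* Quantifying over codes of all rational pairs makes this a countable intersection; codes that give
   no affine minorant satisfy it vacuously. *)
have ae_minor : {ae P, forall w, forall n,
    if unpickle n is Some ab then
      (forall y, 0 <= y -> ratr ab.1 * y + ratr ab.2 <= U y)%R ->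
      (ratr (ab : rat * rat).1 * g w + ratr ab.2 <= h w)%R else True}.
  apply/ae_foralln => n; case: unpickle => [ab|]; last exact: aeW.
  have [abU|nabU] := pselect (forall y, 0 <= y -> ratr ab.1 * y + ratr ab.2 <= U y)%R.
    by apply: filterS (minor _ abU) => w hw _.
  by apply: aeW => w /nabU.
(* where [g] vanishes so does [f], which settles a possible jump of [U] at 0 *)
have ae_zero : {ae P, forall w, (g @^-1` [set 0%R]) w -> (U 0 <= h w)%R}.
  have GD : G (g @^-1` [set 0%R]) by apply: Gg; exists [set 0%R]; rewrite ?setTI.
  apply: ae_le_of_integral_le => //.
  - by apply/sub_measurableP; exact: measurable_cst.
  - exact: finite_measure_integrable_cst.
  move=> B GB BD; have mB := Gm GB; rewrite eh//.
  have mfB : measurable_fun B (EFin \o f).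
    by apply: measurable_funTS; exact: measurable_int intf.
  have : \int[P]_(w in B) `|(f w)%:E| = 0.
    under eq_integral do rewrite gee0_abs ?lee_fin//.
    rewrite -eg//; apply: integral0_eq => w Bw.
    by rewrite (BD w Bw).
  move/(ae_eq_integral_abs P mB mfB) => f0B.
  rewrite le_eqVlt; apply/orP; left; apply/eqP; apply: ae_eq_integral => //.
    by apply: measurable_funTS; exact: measurable_int intUf.
  by apply: filterS f0B => w /[apply] /= -[->].
apply: filterS2 ae_minor ae_zero => w minw zw.
have := g0 w; rewrite le_eqVlt => /predU1P[gw|gw].
  by rewrite -gw; apply: zw; rewrite /= -gw.
apply/ler_addgt0Pr => e e0.
have [a [b [abU]]] := convex_ge0_rat_minorant cU gw e0.
have := minw (pickle (a, b)); rewrite pickleK/= => /(_ abU); lra.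
Qed.

(** By Jensen [U \o g] is almost surely squeezed between the constant [c] and the integrable
    function [h], so it is integrable as well. *)
Lemma cond_exp_jensen_integrable (U : R -> R) c f g : convex_ge0 U ->
  (forall x, 0 <= x -> c <= U x)%R ->
  P.-integrable setT (EFin \o f) -> (forall w, (0 <= f w)%R) ->
  P.-integrable setT (EFin \o (U \o f)) ->
  is_cond_exp P G f g -> (forall w, (0 <= g w)%R) ->
  P.-integrable setT (EFin \o (U \o g)) /\
  \int[P]_w (U (g w))%:E <= \int[P]_w (U (f w))%:E.
Proof.
move=> cU Uc intf f0 intUf fg g0.
have GT := sigma_algebra_setT sG.
have [h fh] := cond_exp_lbound_exists intUf (fun w => Uc _ (f0 w)).
have Ugh := cond_exp_jensen cU intf f0 intUf fg g0 fh.
have [Gh inth eh] := fh; have [Gg intg eg] := fg.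
have mUg : measurable_fun setT (U \o g).
  by apply: measurable_convex_comp => //; exact: sub_measurable_measurable.
have intUg : P.-integrable setT (EFin \o (U \o g)).
  apply/integrableP; split; first exact/measurable_EFinP.
  have /integrable_lty intb : P.-integrable setT (fun w => `|(h w)%:E| + `|c%:E|).
    apply: integrableD => //; first exact: integrable_abse inth.
    exact: finite_measure_integrable_cst.
  apply: le_lt_trans (intb _) => //.
  apply: ae_ge0_le_integral => //.
  - by apply: measurableT_comp => //; exact/measurable_EFinP.
  - by move=> w _; rewrite adde_ge0.
  - apply: emeasurable_funD => //; apply: measurableT_comp => //.
    exact: measurable_int inth.
  apply: filterS Ugh => w Ugh _ /=; rewrite -EFinD lee_fin.
  have := Uc _ (g0 w); have := ler_norm (h w); have := ler_norm (- c)%R; rewrite normrN.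
  by have := normr_ge0 (h w); have := normr_ge0 c; rewrite ler_norml => *; lra.
split => //.
rewrite -[leRHS]eh//; exact: ae_le_integral.
Qed.

End conditional_expectation.

Lemma cond_exp_tower d (W : measurableType d) (R : realType) (P : probability W R)
    (G G' : set (set W)) (f g h : W -> R) : G' `<=` G ->
  is_cond_exp P G f g -> is_cond_exp P G' f h -> is_cond_exp P G' g h.
Proof.
move=> GG' [_ _ eg] [Gh inth eh]; split => // B G'B.
by rewrite eh// eg//; exact: GG'.
Qed.

(** * Backward martingale convergence *)

Lemma cvgn_EFin (R : realType) (u : R^nat) (l : R) :
  u n @[n --> \oo] --> l -> (u n)%:E @[n --> \oo] --> l%:E.
Proof. by move=> ul; apply/fine_cvgP; split => //; exact: nearW. Qed.

Lemma strict_subsequence (N : nat -> nat) :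
  exists2 k : nat -> nat, (forall i, (N i <= k i)%N) & {homo k : i j / (i < j)%N}.
Proof.
pose k := fix k i := if i is j.+1 then maxn (N i) (k j).+1 else N 0%N.
exists k; first by case=> //= i; rewrite leq_maxl.
by apply: homo_ltn; [exact: ltn_trans|move=> i; rewrite /= leq_maxr].
Qed.

Lemma cvgn_summable_increments (R : realType) (u : R^nat) :
  \sum_(0 <= n <oo) `|u n.+1 - u n|%:E < +oo -> cvgn u.
Proof.
move=> su; have S0 : 0 <= \sum_(0 <= n <oo) `|u n.+1 - u n|%:E.
  by apply: nneseries_ge0 => n _ _; rewrite lee_fin.
have : cvgn (series (telescope u)).
  apply: normed_cvg; apply: nondecreasing_is_cvgn.
    by apply: nondecreasing_series => n _ _; exact: normr_ge0.
  exists (fine (\sum_(0 <= n <oo) `|u n.+1 - u n|%:E)) => _ [n _ <-].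
  rewrite -lee_fin fineK ?ge0_fin_numE// /series /= -sumEFin.
  exact: nneseries_lim_ge.
move=> cs; have -> : u = (fun n => u 0%N + series (telescope u) n)%R.
  by apply/funext => n; exact: eq_sum_telescope.
by apply: is_cvgD => //; exact: is_cvg_cst.
Qed.

(** Lets the lower limit be computed from terms of index at least [N], which is what makes it
    measurable for the tail sigma-field. *)
Lemma limn_einf_addn (R : realType) (N : nat) (u : (\bar R)^nat) :
  limn_einf (fun n => u (n + N)%N) = limn_einf u.
Proof.
rewrite !limn_einf_lim.
have -> : einfs (fun n => u (n + N)%N) = (fun n => einfs u (n + N)%N).
  apply/funext => n; rewrite /einfs; congr ereal_inf.
  apply/seteqP; split => [_ [k /= nk <-]|_ [k /= nk <-]].
    by exists (k + N)%N => //=; rewrite leq_add2r.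
  exists (k - N)%N => /=; first by rewrite leq_subRL ?(leq_trans _ nk) ?leq_addl// addnC.
  by rewrite subnK// (leq_trans _ nk)// leq_addl.
apply/cvg_lim => //.
have := @is_cvg_einfs _ u.
by rewrite -(cvg_shiftn N).
Qed.

Lemma measurable_fun_limn_einf d (T : measurableType d) (R : realType)
    (D : set T) (f : (T -> \bar R)^nat) :
  (forall n, measurable_fun D (f n)) ->
  measurable_fun D (fun x => limn_einf (f ^~ x)).
Proof.
move=> mf; apply: measurableT_comp => //.
by apply: (@measurable_fun_limn_esup _ _ _ _ (fun n x => - f n x)) => n; exact: measurableT_comp.
Qed.

Section inv1p.
Context (R : realType).
Implicit Types x y : R.
Local Open Scope ring_scope.

Lemma convex_inv1p : convex_ge0 (fun x : R => (1 + x)^-1).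
Proof.
move=> x y l x0 y0 l0 l1.
have x1 : 0 < 1 + x by rewrite ltr_wpDr.
have y1 : 0 < 1 + y by rewrite ltr_wpDr.
have l1' : 0 <= 1 - l by rewrite subr_ge0.
have xy1 : 0 < 1 + (l * x + (1 - l) * y) by rewrite ltr_wpDr// addr_ge0// mulr_ge0.
rewrite -subr_ge0.
have -> : l * (1 + x)^-1 + (1 - l) * (1 + y)^-1 - (1 + (l * x + (1 - l) * y))^-1 =
    l * (1 - l) * (x - y) ^+ 2 / ((1 + x) * (1 + y) * (1 + (l * x + (1 - l) * y))).
  by field; rewrite !gt_eqF.
apply: divr_ge0; first exact: mulr_ge0 (mulr_ge0 l0 l1') (sqr_ge0 _).
by rewrite ltW// !mulr_gt0.
Qed.

(** Quantitative strict convexity: the midpoint defect controls the squared difference of the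
    values. The difference of the two sides is an explicit nonnegative fraction. *)
Lemma inv1p_midpoint_gap x y : 0 <= x -> 0 <= y ->
  ((1 + x)^-1 - (1 + y)^-1) ^+ 2 <=
  2 * ((1 + x)^-1 + (1 + y)^-1) - 4 * (1 + 2^-1 * (x + y))^-1.
Proof.
move=> x0 y0.
have x1 : 0 < 1 + x by rewrite ltr_wpDr.
have y1 : 0 < 1 + y by rewrite ltr_wpDr.
have xy1 : 0 < 1 + 2^-1 * (x + y) by rewrite ltr_wpDr// mulr_ge0// addr_ge0.
have xy2 : 0 < 2 + x + y by rewrite ltr_wpDr// ltr_wpDr.
rewrite -subr_ge0.
have -> : 2 * ((1 + x)^-1 + (1 + y)^-1) - 4 * (1 + 2^-1 * (x + y))^-1 -
    ((1 + x)^-1 - (1 + y)^-1) ^+ 2 =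
    (x - y) ^+ 2 * (x + y + 2 * x * y) / ((1 + x) ^+ 2 * (1 + y) ^+ 2 * (2 + x + y)).
  field; rewrite !gt_eqF//=.
apply: divr_ge0; last by rewrite ltW// !mulr_gt0// exprn_gt0.
by rewrite mulr_ge0 ?sqr_ge0// !addr_ge0// !mulr_ge0.
Qed.

Lemma inv1p_gt0 x : 0 <= x -> 0 < (1 + x)^-1.
Proof. by move=> x0; rewrite invr_gt0 ltr_wpDr. Qed.

Lemma inv1p_le1 x : 0 <= x -> (1 + x)^-1 <= 1.
Proof. by move=> x0; rewrite invf_le1 ?ltr_wpDr// lerDl. Qed.

End inv1p.

Lemma bounded_integrable d (W : measurableType d) (R : realType)
    (P : probability W R) (F : W -> R) (c : R) :
  measurable_fun setT F -> (forall w, `|F w| <= c)%R ->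
  P.-integrable setT (EFin \o F).
Proof.
move=> mF Fc; apply: (@le_integrable _ _ _ P setT measurableT (EFin \o F) (cst c%:E)) => //.
- exact/measurable_EFinP.
- by move=> w _ /=; rewrite lee_fin (le_trans (Fc w))// ler_norm.
- exact: finite_measure_integrable_cst.
Qed.

Section backward_convergence.
Context d (W : measurableType d) (R : realType) (P : probability W R).
Variables (G : nat -> set (set W)) (f : W -> R) (f_ : nat -> W -> R).
Hypothesis sG : forall n, sigma_algebra setT (G n).
Hypothesis Gm : forall n, G n `<=` measurable.
Hypothesis Gdecr : forall n m, (n <= m)%N -> G m `<=` G n.
Hypothesis intf : P.-integrable setT (EFin \o f).
Hypothesis f0 : forall w, (0 <= f w)%R.
Hypothesis f_ce : forall n, is_cond_exp P (G n) f (f_ n).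
Hypothesis f_0 : forall n w, (0 <= f_ n w)%R.

Let D n w := ((1 + f_ n w)^-1)%R.
Let e n := (\int[P]_w D n w)%R.

Let mf_ n : measurable_fun setT (f_ n).
Proof. by have [h _ _] := f_ce n; exact: sub_measurable_measurable h. Qed.

Let intf_ n : P.-integrable setT (EFin \o f_ n).
Proof. by have [] := f_ce n. Qed.

Let D0 n w : (0 < D n w)%R. Proof. exact: inv1p_gt0. Qed.
Let D1 n w : (D n w <= 1)%R. Proof. exact: inv1p_le1. Qed.

Let mD n : measurable_fun setT (D n).
Proof. exact: measurable_convex_comp (@convex_inv1p R) (f_0 n) (mf_ n). Qed.

Let intD n : P.-integrable setT (EFin \o D n).
Proof.
apply: (@bounded_integrable _ _ _ P _ 1%R) => // w.
by rewrite ger0_norm ?D1// ltW.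
Qed.

Let f_ce_nm n m : (n <= m)%N -> is_cond_exp P (G m) (f_ n) (f_ m).
Proof. by move=> nm; exact: cond_exp_tower (Gdecr nm) (f_ce n) (f_ce m). Qed.

Let mid n m w := (2^-1 * (f_ n w + f_ m w))%R.

Let mid0 n m w : (0 <= mid n m w)%R.
Proof. by rewrite mulr_ge0// addr_ge0. Qed.

Let int_mid n m : P.-integrable setT (EFin \o mid n m).
Proof.
rewrite (_ : EFin \o _ =
  (fun w => (2^-1)%:E * ((EFin \o f_ n) \+ (EFin \o f_ m)) w)).
  by apply: integrableZl => //; exact: integrableD.
by apply/funext => w /=; rewrite -EFinD -EFinM.
Qed.

(** Both [f_ n] and [f_ m] have conditional expectation [f_ m] given [G m], hence so does their
    midpoint. Jensen then bounds the expected transform of the midpoint below by [e m]. *)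
Let mid_ce n m : (n <= m)%N -> is_cond_exp P (G m) (mid n m) (f_ m).
Proof.
move=> nm; have [Gf intfm ef] := f_ce_nm nm; split => // B GB.
have mB := Gm GB.
under [RHS]eq_integral do rewrite EFinM EFinD.
have intB i : P.-integrable B (EFin \o f_ i) by exact: integrableS (intf_ i).
rewrite integralZl//; last exact: integrableD (intB n) (intB m).
rewrite integralD//; [|exact: intB|exact: intB].
rewrite /= -ef//.
have := integrable_fin_num mB (intB m) => /=.
by case: (integral _ _ _) => //= r _; rewrite -EFinD -EFinM; congr EFin; field.
Qed.

Let Dmid_int n m : P.-integrable setT (EFin \o (fun w => (1 + mid n m w)^-1)%R).
Proof.
apply: (@bounded_integrable _ _ _ P _ 1%R).
  apply: measurable_convex_comp (@convex_inv1p R) (mid0 n m) _.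
  exact/measurable_EFinP/(measurable_int _ (int_mid n m)).
by move=> w; rewrite ger0_norm ?inv1p_le1// ltW// inv1p_gt0.
Qed.

Let inv1p_jensen m F : P.-integrable setT (EFin \o F) -> (forall w, (0 <= F w)%R) ->
  P.-integrable setT (EFin \o (fun w => (1 + F w)^-1)%R) ->
  is_cond_exp P (G m) F (f_ m) -> (e m <= \int[P]_w ((1 + F w)^-1)%R)%R.
Proof.
move=> intF F0 intDF ceF.
have inv0 (x : R) : (0 <= x -> 0 <= (1 + x)^-1)%R.
  by move=> x0; rewrite ltW// inv1p_gt0.
have [_ h] := cond_exp_jensen_integrable (sG m) (@Gm m) (@convex_inv1p R)
  inv0 intF F0 intDF ceF (f_0 m).
rewrite /e /Rintegral fine_le//; first exact: (integrable_fin_num _ (intD m)).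
exact: (integrable_fin_num _ intDF).
Qed.

Let e_noninc n m : (n <= m)%N -> (e m <= e n)%R.
Proof. by move=> nm; apply: inv1p_jensen => //; [exact: intD|exact: f_ce_nm]. Qed.

Let int_sq n m : P.-integrable setT (EFin \o (fun w => (D n w - D m w) ^+ 2)%R).
Proof.
apply: (@bounded_integrable _ _ _ P _ 1%R).
  by apply: measurable_funX; exact: measurable_funB.
move=> w; rewrite normrX -(expr1n _ 2) lerXn2r ?nnegrE//.
have := D0 n w; have := D1 n w; have := D0 m w; have := D1 m w.
by rewrite ler_norml => *; lra.
Qed.

(** Integrating the midpoint gap leaves [2 * (e n + e m)] minus four times the expected transform of
    the midpoint, and the latter is at least [e m]. *)
Let sq_increment n m : (n <= m)%N ->
  (\int[P]_w (D n w - D m w) ^+ 2 <= 2 * (e n - e m))%R.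
Proof.
move=> nm.
have h := inv1p_jensen (int_mid n m) (mid0 n m) (Dmid_int n m) (mid_ce nm).
pose F w := (2 * (D n w + D m w) - 4 * (1 + mid n m w)^-1)%R.
have intDD : P.-integrable setT (EFin \o (fun w => D n w + D m w)%R).
  rewrite (_ : EFin \o _ = (EFin \o D n) \+ (EFin \o D m)).
    by apply: integrableD => //; exact: intD.
  by apply/funext => w.
have int2 : P.-integrable setT (EFin \o (fun w => 2 * (D n w + D m w))%R).
  rewrite (_ : EFin \o _ = (fun w => 2%:E * (EFin \o (fun w => D n w + D m w)%R) w)).
    exact: integrableZl.
  by apply/funext => w.
have int4 : P.-integrable setT (EFin \o (fun w => 4 * (1 + mid n m w)^-1)%R).
  rewrite (_ : EFin \o _ = (fun w => 4%:E * (EFin \o (fun w => (1 + mid n m w)^-1)%R) w)).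
    exact: integrableZl.
  by apply/funext => w.
have intF : P.-integrable setT (EFin \o F).
  rewrite (_ : EFin \o _ = (EFin \o (fun w => 2 * (D n w + D m w))%R) \-
    (EFin \o (fun w => 4 * (1 + mid n m w)^-1)%R)); first exact: integrableB.
  by apply/funext => w.
apply: (@le_trans _ _ (\int[P]_w F w)%R).
  apply: le_Rintegral => //.
  by move=> w _; exact: inv1p_midpoint_gap.
rewrite RintegralB// !RintegralZl// RintegralD//.
rewrite -/(e n) -/(e m); move: h; set a := Rintegral _ _ _; lra.
Qed.

(** Intended L^2 size of the increments along the subsequence; the dyadic form makes the resulting
    L^1 bounds [b k + b k] summable. *)
Let b (k : nat) : R := (1 / (2 ^ k.+1)%:R)%R.

Let b0 k : (0 < b k)%R. Proof. by rewrite divr_gt0// ltr0n expn_gt0. Qed.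

(* By [sq_increment] the increments of [D] are small in L^2 as soon as the
   nonincreasing sequence [e] is close to its limit. *)
Let good_subsequence : exists2 k : nat -> nat, {homo k : i j / (i < j)%N} &
  forall i, (\int[P]_w (D (k i) w - D (k i.+1) w) ^+ 2 <= b i ^+ 2)%R.
Proof.
have e_ge0 n : (0 <= e n)%R.
  by apply: Rintegral_ge0 => w _; rewrite ltW.
have hinf : has_inf (range e).
  by split; [exists (e 0%N), 0%N|exists 0%R => _ [n _ <-]].
have /choice[N HN] : forall i, exists N, forall m, (N <= m)%N ->
    (2 * (e N - e m) <= b i ^+ 2)%R.
  move=> i; have bi : (0 < b i ^+ 2 / 2)%R by rewrite divr_gt0// exprn_gt0.
  have [_ [N _ <-] eN] := inf_adherent bi hinf.
  exists N => m _; have : (inf (range e) <= e m)%R by apply: (ge_inf hinf.2); exists m.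
  by lra.
have [k Nk kinc] := strict_subsequence N; exists k => // i.
have kk : (k i <= k i.+1)%N by rewrite ltnW// kinc.
apply: (le_trans (sq_increment kk)).
apply: le_trans (HN i (k i.+1) (leq_trans (Nk i) kk)).
by have := e_noninc (Nk i); lra.
Qed.

Let ae_cvg_inv1p k :
  (forall i, (\int[P]_w (D (k i) w - D (k i.+1) w) ^+ 2 <= b i ^+ 2)%R) ->
  {ae P, forall w, cvgn (fun i => D (k i) w)}.
Proof.
move=> hk; pose inc i w := `|D (k i.+1) w - D (k i) w|%:E.
have minc i : measurable_fun setT (inc i).
  by apply/measurable_EFinP; apply: measurableT_comp => //; exact: measurable_funB.
have int_inc i : \int[P]_w inc i w <= (2 / (2 ^ i.+1)%:R)%:E.
  (* The elementary bound [|x| <= x^2 / b + b] turns the L^2 estimate into an L^1 one without the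
     Cauchy-Schwarz inequality. *)
  pose F w := ((b i)^-1 * (D (k i) w - D (k i.+1) w) ^+ 2 + b i)%R.
  apply: (@le_trans _ _ (\int[P]_w (F w)%:E)).
    apply: ge0_le_integral => //.
    - by move=> w _; rewrite lee_fin.
    - apply/measurable_EFinP; apply: measurable_funD => //.
      apply: measurable_funM => //.
      by apply: measurable_funX; exact: measurable_funB.
    - move=> w _; rewrite lee_fin /F.
      have := D0 (k i) w; move: (D _ w) (D _ w) => x y _.
      have bi := b0 i; rewrite -(ler_pM2l bi) mulrDr mulVKf ?gt_eqF//.
      rewrite distrC -[X in (_ <= X + _)%R]real_normK ?num_real//.
      by have := sqr_ge0 (`|x - y| - b i)%R; have := normr_ge0 (x - y)%R; nra.
  rewrite integral_affine//.
  rewrite probability_setT mule1.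
  have -> : \int[P]_w ((D (k i) w - D (k i.+1) w) ^+ 2)%:E =
      (\int[P]_w (D (k i) w - D (k i.+1) w) ^+ 2)%R%:E.
    by rewrite /Rintegral fineK//; exact: (integrable_fin_num _ (int_sq _ _)).
  rewrite -EFinM -EFinD lee_fin.
  have -> : (2 / (2 ^ i.+1)%:R = b i + b i)%R by rewrite /b; field; rewrite pnatr_eq0 expn_eq0.
  by rewrite lerD2r ler_pdivrMl// -expr2 hk.
have int_sum : \int[P]_w (\sum_(0 <= i <oo) inc i w) < +oo.
  rewrite integral_nneseries//; last by move=> *; rewrite lee_fin.
  apply: (@le_lt_trans _ _ (2%:E)); last exact: ltry.
  apply: le_trans (epsilon_trick0 xpredT (ler0n _ 2)).
  by apply: lee_nneseries => // i _ _; apply: integral_ge0 => w _; rewrite lee_fin.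
have sum0 w : 0 <= \sum_(0 <= i <oo) inc i w.
  by apply: nneseries_ge0 => i _ _; rewrite lee_fin.
have isum : P.-integrable setT (fun w => \sum_(0 <= i <oo) inc i w).
  apply/integrableP; split.
    by apply: ge0_emeasurable_sum => // i w _ _; rewrite lee_fin.
  by under eq_integral do rewrite gee0_abs//.
apply: filterS (integrable_ae measurableT isum) => w /(_ Logic.I) fw.
apply: cvgn_summable_increments.
by move: fw; rewrite (ge0_fin_numE (sum0 w)).
Qed.

(** The candidate limit is the lower limit in the extended reals, which is defined everywhere and
    measurable for every [G n]. Fatou's lemma on tail events makes it almost surely finite and at
    most [Y]; equality of the total integrals then forces it to be [Y] almost surely. *)
Lemma backward_martingale_subsequence_cvg Y :
  is_cond_exp P (\bigcap_n G n) f Y ->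
  exists2 k : nat -> nat, {homo k : i j / (i < j)%N} &
    {ae P, forall w, f_ (k i) w @[i --> \oo] --> Y w}.
Proof.
move=> [TY intY eY].
have [k kinc hk] := good_subsequence; exists k => //.
have Dcvg := ae_cvg_inv1p hk.
have kid i : (i <= k i)%N.
  by elim: i => // i ih; rewrite (leq_ltn_trans ih)// kinc.
pose T := \bigcap_n G n.
have sT : sigma_algebra setT T by exact: bigcap_sigma_algebra.
have Tm : T `<=` measurable by move=> B /(_ 0%N Logic.I); exact: Gm.
have TT := sigma_algebra_setT sT.
pose L' w := limn_einf (fun i => (f_ (k i) w)%:E).
have L'0 w : 0 <= L' w.
  rewrite /L' limn_einf_lim; apply: lime_ge; first exact: is_cvg_einfs.
  apply: nearW => n; apply: le_ereal_inf_tmp => _ [m _ <-].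
  by rewrite lee_fin.
have mL'G n : measurable_fun setT (L' : g_sigma_algebraType (G n) -> \bar R).
  rewrite (_ : L' = (fun w => limn_einf (fun i => (f_ (k (i + n)%N) w)%:E))); last first.
    by apply/funext => w; rewrite (limn_einf_addn n (fun i => (f_ (k i) w)%:E)).
  apply: (@measurable_fun_limn_einf _ (g_sigma_algebraType (G n)) R setT
    (fun i w => (f_ (k (i + n)%N) w)%:E)) => i.
  apply/measurable_EFinP; apply/(sub_measurableP (sG n)).
  have [h _ _] := f_ce (k (i + n)%N).
  apply: subset_trans h _; apply: Gdecr.
  by rewrite (leq_trans _ (kid _))// leq_addl.
have mL' : measurable_fun setT L'.
  move=> _ B mB; apply: (@Gm 0%N); rewrite -(sigma_algebra_id (sG 0%N)).
  exact: mL'G.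
have fatouB B : T B -> \int[P]_(w in B) L' w <= \int[P]_(w in B) (f w)%:E.
  move=> TB; have mB := Tm _ TB.
  apply: (le_trans (fatou P mB (f := fun i w => (f_ (k i) w)%:E) _ _)).
  - by move=> n; apply: measurable_funTS; exact/measurable_EFinP.
  - by move=> n w _; rewrite lee_fin.
  (* A tail event belongs to every [G (k n)], so the integrals of the conditional expectations over
     it are all equal. *)
  rewrite (_ : (fun n => _) = cst (\int[P]_(w in B) (f w)%:E)).
    by have [-> _] := cvg_limn_einf_sup (cvg_cst (\int[P]_(w in B) (f w)%:E)).
  apply/funext => n; have [_ _] := f_ce (k n); apply; exact: TB.
have intL' : P.-integrable setT L'.
  apply/integrableP; split => //.
  under eq_integral do rewrite gee0_abs//.
  by apply: le_lt_trans (fatouB _ TT) _; exact: integrable_lty.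
have L'fin : {ae P, forall w, L' w \is a fin_num}.
  by apply: filterS (integrable_ae measurableT intL') => w; apply.
pose L := fine \o L'.
have TL : sub_measurable T L.
  move=> B LB n _; apply: (sub_measurableP (sG n) L).2 LB.
  exact: measurableT_comp.
have mL : measurable_fun setT L by exact: measurableT_comp.
have LL' : ae_eq P setT L' (EFin \o L).
  by apply: filterS L'fin => w fw _ /=; rewrite fineK.
have L0 w : (0 <= L w)%R by exact: fine_ge0.
have intLE B : measurable B -> \int[P]_(w in B) (L w)%:E = \int[P]_(w in B) L' w.
  move=> mB; apply: ae_eq_integral => //.
  - by apply: measurable_funTS; exact/measurable_EFinP.
  - exact: measurable_funTS.
  by apply: filterS LL' => w + _; move=> /(_ Logic.I) ->.
have intL : P.-integrable setT (EFin \o L).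
  apply/integrableP; split; first exact/measurable_EFinP.
  under eq_integral do rewrite /= ger0_norm//.
  by rewrite intLE//; apply: integrable_lty.
have LY : {ae P, forall w, (L w <= Y w)%R}.
  have : {ae P, forall w, setT w -> (L w <= Y w)%R}.
    apply: (ae_le_of_integral_le sT Tm) => // B TB _.
    by rewrite intLE ?eY//; [exact: fatouB|exact: Tm].
  by apply: filterS => w; apply.
have cvgL : {ae P, forall w, f_ (k i) w @[i --> \oo] --> L w}.
  apply: filterS2 Dcvg L'fin => w Dw fw.
  have D_ge0 : (0 <= limn (fun i => D (k i) w))%R.
    by apply: limr_ge => //; apply: nearW => i; rewrite ltW.
  have fE i : f_ (k i) w = ((D (k i) w)^-1 - 1)%R by rewrite /D invrK addrC addKr.
  have [Dz|Dz] := eqVneq (limn (fun i => D (k i) w)) 0%R.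
    (* A zero limit of the transforms would send [f_ (k i) w] to infinity, against the finiteness of
       the lower limit. *)
    exfalso; move: fw; rewrite /L'.
    suff : (f_ (k i) w)%:E @[i --> \oo] --> +oo.
      by move/cvg_limn_einf_sup => [-> _].
    apply/cvgeryP; apply/cvgryPge => A.
    have A0 : (0 < (1 + `|A|)^-1)%R by rewrite inv1p_gt0.
    have := Dw => /cvgrPdist_lt /(_ _ A0); apply: filterS => i.
    rewrite Dz sub0r normrN ger0_norm; last by rewrite ltW.
    have A1 : (0 < 1 + `|A|)%R by rewrite ltr_wpDr.
    have f1 : (0 < 1 + f_ (k i) w)%R by rewrite ltr_wpDr.
    rewrite /D ltf_pV2 ?posrE// ltrD2l => /ltW.
    exact: le_trans (ler_norm _).
  have fcvg : f_ (k i) w @[i --> \oo] --> ((limn (fun i => D (k i) w))^-1 - 1)%R.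
    under eq_fun do rewrite fE.
    by apply: cvgB; [exact: cvgV|exact: cvg_cst].
  rewrite /L /= /L'.
  have : (f_ (k i) w)%:E @[i --> \oo] --> ((limn (fun i => D (k i) w))^-1 - 1)%:E.
    exact: cvgn_EFin.
  by move/cvg_limn_einf_sup => [-> _].
(* Jensen's inequality for [x |-> - min x K] prevents loss of mass at infinity. *)
have fL : \int[P]_w (f w)%:E <= \int[P]_w (L w)%:E.
  pose trunc (K : nat) (F : W -> R) w := Num.min (F w) K%:R.
  have mtrunc K (F : W -> R) : measurable_fun setT F -> measurable_fun setT (trunc K F).
    by move=> mF; exact: measurable_minr.
  have trunc0 K (F : W -> R) w : (0 <= F w)%R -> (0 <= trunc K F w <= K%:R)%R.
    by move=> F0; rewrite le_min F0 ler0n/= ge_min lexx orbT.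
  have inttrunc K (F : W -> R) : measurable_fun setT F -> (forall w, (0 <= F w)%R) ->
      P.-integrable setT (EFin \o trunc K F).
    move=> mF F0; apply: (@bounded_integrable _ _ _ P _ K%:R); first exact: mtrunc.
    by move=> w; have /andP[? ?] := trunc0 K F w (F0 w); rewrite ger0_norm.
  have mf : measurable_fun setT f by exact/measurable_EFinP/(measurable_int _ intf).
  have truncL K : \int[P]_w (trunc K f w)%:E <= \int[P]_w (trunc K L w)%:E.
    have cvx : convex_ge0 (fun x : R => - Num.min x K%:R)%R.
      move=> x y l x0 y0 l0 l1; rewrite lerNl opprD !mulrN !opprK le_min; apply/andP; split.
        by apply: lerD; rewrite ler_wpM2l ?subr_ge0// ge_min lexx.
      apply: (@le_trans _ _ (l * K%:R + (1 - l) * K%:R)%R); last by rewrite -mulrDl addrC subrK mul1r.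
      by apply: lerD; rewrite ler_wpM2l ?subr_ge0// ge_min lexx orbT.
    have bnd (x : R) : (0 <= x -> - K%:R <= - Num.min x K%:R)%R.
      by move=> _; rewrite lerN2 ge_min lexx orbT.
    have intN (F : W -> R) : measurable_fun setT F -> (forall w, (0 <= F w)%R) ->
        P.-integrable setT (EFin \o (fun w => - trunc K F w)%R).
      by move=> mF F0; exact: integrableN (inttrunc K F mF F0).
    have trunc_n n : \int[P]_w (trunc K f w)%:E <= \int[P]_w (trunc K (f_ n) w)%:E.
      have [_] := cond_exp_jensen_integrable (sG n) (@Gm n) cvx bnd intf f0
        (intN f mf f0) (f_ce n) (f_0 n).
      under eq_integral do rewrite EFinN.
      under [leRHS]eq_integral do rewrite EFinN.
      rewrite !integral_ge0N; first by rewrite leeN2.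
      + by move=> w _; rewrite lee_fin; have /andP[] := trunc0 K f w (f0 w).
      + by move=> w _; rewrite lee_fin; have /andP[] := trunc0 K (f_ n) w (f_0 n w).
    have cvtrunc : {ae P, forall w, setT w ->
        (trunc K (f_ (k i)) w)%:E @[i --> \oo] --> (trunc K L w)%:E}.
      apply: filterS cvgL => w cw _; apply: cvgn_EFin.
      apply/cvgrPdist_le => eps eps0; move/cvgrPdist_le : cw => /(_ _ eps0).
      apply: filterS => i; apply: le_trans; rewrite /trunc.
      by case: (leP (L w) K%:R); case: (leP (f_ (k i) w) K%:R) => h1 h2;
        rewrite ?subrr ?normr0// ler_norml; have := ler_norm (L w - f_ (k i) w)%R;
        have := ler_norm (- (L w - f_ (k i) w))%R; rewrite normrN => *; lra.
    have bdtrunc : {ae P, forall w i, setT w ->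
        `|(trunc K (f_ (k i)) w)%:E| <= cst K%:R%:E w}.
      apply: aeW => w i _; rewrite /= lee_fin.
      by have /andP[h1 h2] := trunc0 K (f_ (k i)) w (f_0 _ w); rewrite ger0_norm.
    have [_ _ cv] := dominated_convergence measurableT
      (fun i => iffRL (measurable_EFinP _ _) (mtrunc K _ (mf_ (k i))))
      (iffRL (measurable_EFinP _ _) (mtrunc K _ mL)) cvtrunc
      (finite_measure_integrable_cst P _ measurableT) bdtrunc.
    rewrite -(cvg_lim _ cv)//; apply: lime_ge; first by apply/cvg_ex; eexists; exact: cv.
    by apply: nearW => i; exact: trunc_n.
  (* The truncation level is now removed: by monotone convergence on the side of [f], and because
     truncations stay below [L] on the other side. *)
  have -> : \int[P]_w (f w)%:E = limn (fun K => \int[P]_w (trunc K f w)%:E).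
    rewrite -monotone_convergence//.
    - apply: eq_integral => w _; apply/esym/cvg_lim => //.
      apply: cvgn_EFin; apply: (@cvg_near_cst) => //.
      near=> K; rewrite /trunc (min_idPl _)//.
      near: K; exact: nbhs_infty_ger.
    - by move=> K; apply/measurable_EFinP; exact: mtrunc.
    - by move=> K w _; rewrite lee_fin; have /andP[] := trunc0 K f w (f0 w).
    - move=> w _ K K' KK'; rewrite lee_fin /trunc le_min ge_min lexx/=.
      by rewrite ge_min ler_nat KK' orbT.
  apply: lime_le.
    apply: ereal_nondecreasing_is_cvgn => K K' KK'.
    apply: ge0_le_integral => //.
    - by move=> w _; rewrite lee_fin; have /andP[] := trunc0 K f w (f0 w).
    - by apply/measurable_EFinP; exact: mtrunc.
    - by apply/measurable_EFinP; exact: mtrunc.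
    - move=> w _; rewrite lee_fin /trunc le_min ge_min lexx/=.
      by rewrite ge_min ler_nat KK' orbT.
  apply: nearW => K; apply: (le_trans (truncL K)).
  apply: ge0_le_integral => //.
  - by move=> w _; rewrite lee_fin; have /andP[] := trunc0 K L w (L0 w).
  - by apply/measurable_EFinP; exact: mtrunc.
  - exact/measurable_EFinP.
  - by move=> w _; rewrite lee_fin ge_min lexx.
have YL : {ae P, forall w, L w = Y w}.
  have intYL : P.-integrable setT ((EFin \o Y) \- (EFin \o L)) by exact: integrableB.
  have /(ae_eq_integral_abs P measurableT (measurable_int _ intYL)) :
      \int[P]_w `|((EFin \o Y) \- (EFin \o L)) w| = 0.
    transitivity (\int[P]_w ((EFin \o Y) \- (EFin \o L)) w).
      apply: ae_eq_integral => //.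
      - by apply: measurableT_comp => //; exact: measurable_int intYL.
      - exact: measurable_int intYL.
      by apply: filterS LY => w LYw _; rewrite gee0_abs//= -EFinB lee_fin subr_ge0.
    rewrite integralB//.
    have YE : \int[P]_w (EFin \o Y) w = \int[P]_w (f w)%:E by exact: eY.
    have LE : \int[P]_w (EFin \o L) w = \int[P]_w (f w)%:E.
      by apply/eqP; rewrite eq_le fL andbT [leLHS]intLE// fatouB.
    by rewrite YE LE subee//; exact: (integrable_fin_num _ intf).
  by apply: filterS => w /(_ Logic.I) /= -[] /eqP; rewrite subr_eq0 => /eqP ->.
by apply: filterS2 cvgL YL => w cw <-.
Unshelve. all: by end_near. Qed.

End backward_convergence.

(** * Limit of the entropies *)

Lemma limn_einf_ge_near (R : realType) (u : (\bar R)^nat) (x : \bar R) :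
  (\forall n \near \oo, x <= u n) -> x <= limn_einf u.
Proof.
move=> [N _ xu]; rewrite limn_einf_lim.
apply: lime_ge; first exact: is_cvg_einfs.
exists N => // n /= Nn; apply: le_ereal_inf_tmp => _ [m /= nm <-].
by apply: xu; exact: leq_trans nm.
Qed.

(** On a probability space the lower bound makes the negative part integrable, so an integral below
    [+oo] bounds the positive part too. *)
Lemma integrable_lbound d (W : measurableType d) (R : realType)
    (P : probability W R) (F : W -> R) (c : R) :
  measurable_fun setT F -> (forall w, c <= F w)%R ->
  \int[P]_w (F w)%:E < +oo -> P.-integrable setT (EFin \o F).
Proof.
move=> mF cF intF.
have mEF : measurable_fun setT (EFin \o F) by exact/measurable_EFinP.
have intFn : \int[P]_w (EFin \o F)^\- w < +oo.
  apply: (@le_lt_trans _ _ (\int[P]_w (cst `|c|%:E w))).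
    apply: ge0_le_integral => //; first exact: measurable_funeneg.
    move=> w _; rewrite funenegE /= -EFin_max lee_fin ge_max normr_ge0 andbT.
    by have := cF w; have := ler_norm (- c)%R; rewrite normrN; lra.
  by apply: integrable_lty => //; exact: finite_measure_integrable_cst.
have intFp : \int[P]_w (EFin \o F)^\+ w < +oo.
  move: intF; rewrite integralE => h.
  have fn : \int[P]_w (EFin \o F)^\- w \is a fin_num.
    by rewrite ge0_fin_numE// integral_ge0.
  by move: h; rewrite lteBlDr// addye ?ltry//; case: (integral _ _ (funeneg _)) fn.
apply/integrableP; split => //.
under eq_integral do rewrite -[`|_|]/((abse \o (EFin \o F)) _) fune_abse.
rewrite ge0_integralD//.
- by rewrite lte_add_pinfty.
- exact: measurable_funepos.
- exact: measurable_funeneg.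
Qed.

Lemma integral_distribution_measurable d d' (W : measurableType d)
    (E : measurableType d') (R : realType) (P : probability W R)
    (X : {RV P >-> E}) (f : E -> \bar R) : measurable_fun setT f ->
  \int[distribution P X]_x f x = \int[P]_w f (X w).
Proof.
move=> mf; rewrite [LHS]integralE [RHS]integralE; congr (_ - _).
  rewrite (ge0_integral_distribution X (measurable_funepos mf))//.
  by rewrite -funepos_comp.
rewrite (ge0_integral_distribution X (measurable_funeneg mf))//.
by rewrite -funeneg_comp.
Qed.

Section backward_entropy.
Context d (W : measurableType d) (R : realType) (P : probability W R).
Variables (G : nat -> set (set W)) (f : W -> R) (f_ : nat -> W -> R) (Y : W -> R).
Hypothesis sG : forall n, sigma_algebra setT (G n).
Hypothesis Gm : forall n, G n `<=` measurable.
Hypothesis Gdecr : forall n m, (n <= m)%N -> G m `<=` G n.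
Hypothesis intf : P.-integrable setT (EFin \o f).
Hypothesis f0 : forall w, (0 <= f w)%R.
Hypothesis f_ce : forall n, is_cond_exp P (G n) f (f_ n).
Hypothesis f_0 : forall n w, (0 <= f_ n w)%R.
Hypothesis Y_ce : is_cond_exp P (\bigcap_n G n) f Y.
Hypothesis Y0 : forall w, (0 <= Y w)%R.

Let sT : sigma_algebra setT (\bigcap_n G n).
Proof. exact: bigcap_sigma_algebra. Qed.

Let Tm : \bigcap_n G n `<=` measurable.
Proof. by move=> B /(_ 0%N Logic.I); exact: Gm. Qed.

(** By the tower property [Y] is also the conditional expectation of each [f_ n], so Jensen applies
    from [f_ n] to [Y]. *)
Lemma backward_entropy_ge (U : R -> R) c : convex_ge0 U ->
  (forall x, 0 <= x -> c <= U x)%R -> P.-integrable setT (EFin \o (U \o f)) ->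
  P.-integrable setT (EFin \o (U \o Y)) /\
  forall n, \int[P]_w (U (Y w))%:E <= \int[P]_w (U (f_ n w))%:E.
Proof.
move=> cU Uc intUf.
split; first by have [] := cond_exp_jensen_integrable sT Tm cU Uc intf f0 intUf Y_ce Y0.
move=> n; have [_ intfn _] := f_ce n.
have [intUfn _] := cond_exp_jensen_integrable (sG n) (@Gm n) cU Uc intf f0
  intUf (f_ce n) (f_0 n).
have TG : \bigcap_n G n `<=` G n by move=> B; apply.
have := cond_exp_jensen_integrable sT Tm cU Uc intfn (f_0 n) intUfn
  (cond_exp_tower TG (f_ce n) Y_ce) Y0.
by case.
Qed.

(** Covers the points where [Y] vanishes, to which [convex_ge0_usc] does not apply: the event
    [Y = 0] is a tail event, so the nonnegative [f_ n] has integral 0 over it. *)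
Let zero_on_Y0 : {ae P, forall w, forall n, Y w = 0%R -> f_ n w = 0%R}.
Proof.
apply/ae_foralln => n; have [TY intY eY] := Y_ce; have [Gf intfn ef] := f_ce n.
have TB : (\bigcap_n G n) (Y @^-1` [set 0%R]).
  by apply: TY; exists [set 0%R]; rewrite ?setTI.
have mB := Tm TB.
have mfB : measurable_fun (Y @^-1` [set 0%R]) (EFin \o f_ n).
  by apply: measurable_funTS; exact: measurable_int intfn.
have : \int[P]_(w in Y @^-1` [set 0%R]) `|(f_ n w)%:E| = 0.
  under eq_integral do rewrite gee0_abs ?lee_fin//.
  rewrite ef; last exact: TB.
  rewrite -eY//; apply: integral0_eq => w Bw.
  by rewrite Bw.
move/(ae_eq_integral_abs P mB mfB).
by apply: filterS => w h Yw; have := h Yw => /= -[].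
Qed.

(* Conditional expectations of [U \o f] dominate [U \o f_ n] and converge as
   well, so Fatou's lemma applies to the nonnegative differences. *)
Let backward_entropy_le_ge0 (U : R -> R) : convex_ge0 U ->
  (forall x, 0 <= x -> 0 <= U x)%R -> P.-integrable setT (EFin \o (U \o f)) ->
  forall e : R, (0 < e)%R ->
  exists n, \int[P]_w (U (f_ n w))%:E <= \int[P]_w (U (Y w))%:E + e%:E.
Proof.
move=> cU Upos intUf e e0.
have Uf0 w : (0 <= (U \o f) w)%R by exact: Upos.
have /choice[V HV] : forall n, exists V,
    is_cond_exp P (G n) (U \o f) V /\ forall w, (0 <= V w)%R.
  move=> n; have [V] := cond_exp_ge0_exists (sG n) (@Gm n) intUf Uf0.
  by exists V.
have V_ce n := (HV n).1; have V0 n := (HV n).2.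
have [VY VY_ce VY0] := cond_exp_ge0_exists sT Tm intUf Uf0.
have [k1 k1inc cvf] := backward_martingale_subsequence_cvg sG Gm Gdecr intf f0 f_ce f_0 Y_ce.
have k1id i : (i <= k1 i)%N.
  by elim: i => // i ih; rewrite (leq_ltn_trans ih)// k1inc.
(* The second extraction is made along the first. Thinning a decreasing family keeps its
   intersection, so both limits are conditional expectations given the same tail sigma-field. *)
have capE : \bigcap_n G (k1 n) = \bigcap_n G n.
  apply/seteqP; split => B TB n _; last exact: TB.
  by apply: Gdecr (TB n Logic.I); exact: k1id.
have VY_ce1 : is_cond_exp P (\bigcap_n G (k1 n)) (U \o f) VY by rewrite capE.
have k1mon n m : (n <= m)%N -> (k1 n <= k1 m)%N.
  by rewrite leq_eqVlt => /predU1P[->//|/k1inc/ltnW].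
have [k2 k2inc cvV] := backward_martingale_subsequence_cvg
  (fun n => sG (k1 n)) (fun n => @Gm (k1 n)) (fun n m nm => Gdecr (k1mon n m nm)) intUf Uf0
  (fun n => V_ce (k1 n)) (fun n => V0 (k1 n)) VY_ce1.
have k2id i : (i <= k2 i)%N.
  by elim: i => // i ih; rewrite (leq_ltn_trans ih)// k2inc.
pose k i := k1 (k2 i).
have UV : {ae P, forall w, forall n, (U (f_ n w) <= V n w)%R}.
  apply/ae_foralln => n.
  exact: (cond_exp_jensen (sG n) (@Gm n) cU intf f0 intUf (f_ce n) (f_0 n) (V_ce n)).
have intUfn n : P.-integrable setT (EFin \o (U \o f_ n)).
  by have [] := cond_exp_jensen_integrable (sG n) (@Gm n) cU Upos intf f0
    intUf (f_ce n) (f_0 n).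
have intV n : P.-integrable setT (EFin \o V n) by have [] := V_ce n.
have [intUY _] := backward_entropy_ge cU Upos intUf.
have intVY : P.-integrable setT (EFin \o VY) by have [] := VY_ce.
have EV n : \int[P]_w (V n w)%:E = \int[P]_w (U (f w))%:E.
  by have [_ _] := V_ce n; apply; exact: sigma_algebra_setT.
have EVY : \int[P]_w (VY w)%:E = \int[P]_w (U (f w))%:E.
  by have [_ _] := VY_ce; apply; exact: sigma_algebra_setT.
apply: contrapT => /forallNP nle.
have lt_n n : \int[P]_w (U (Y w))%:E + e%:E < \int[P]_w (U (f_ n w))%:E.
  by rewrite ltNge; exact/negP.
(* The maximum with 0 alters the difference on a null set only and makes it nonnegative everywhere,
   as Fatou's lemma requires. *)
pose a i w := Num.max 0%R (V (k i) w - U (f_ (k i) w))%R.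
have ma i : measurable_fun setT (a i).
  apply: measurable_maxr => //; apply: measurable_funB.
    exact/measurable_EFinP/(measurable_int _ (intV _)).
  exact/measurable_EFinP/(measurable_int _ (intUfn _)).
have Ea i : \int[P]_w (a i w)%:E =
    \int[P]_w (U (f w))%:E - \int[P]_w (U (f_ (k i) w))%:E.
  rewrite -(EV (k i)) -integralB_EFin//; try exact: intV; try exact: intUfn.
  apply: ae_eq_integral => //.
  - exact/measurable_EFinP.
  - by apply: emeasurable_funB; [exact: measurable_int (intV _)|exact: measurable_int (intUfn _)].
  apply: filterS UV => w UVw _ /=.
  by rewrite /a (max_idPr _) ?subr_ge0.
have intdiff : P.-integrable setT (EFin \o (fun w => VY w - U (Y w))%R).
  rewrite (_ : EFin \o _ = (EFin \o VY) \- (EFin \o (U \o Y))); first exact: integrableB.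
  by apply/funext.
have liminf_ge : {ae P, forall w, (VY w - U (Y w))%:E <= limn_einf (fun i => (a i w)%:E)}.
  apply: filterS3 cvf cvV zero_on_Y0 => w cfw cVw Yfw.
  (* A lower bound on the differences calls only for an upper bound on [U (f_ (k i) w)], that is for
     upper semicontinuity at [Y w]. *)
  have Uusc e1 : (0 < e1)%R ->
      \forall i \near \oo, (U (f_ (k i) w) <= U (Y w) + e1)%R.
    move=> e10; have := Y0 w; rewrite le_eqVlt => /predU1P[Yw|Yw].
      by apply: nearW => i; rewrite Yfw// -Yw lerDl ltW.
    have [dl dl0 Udl] := convex_ge0_usc cU Yw e10.
    have /cvgrPdist_lt/(_ _ dl0)[N _ HN] := cfw.
    exists N => // i /= Ni; apply: Udl => //; rewrite distrC; apply: HN => /=.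
    exact: leq_trans (k2id i).
  apply/lee_addgt0Pr => e1 e10; rewrite -leeBlDr// -EFinB.
  apply: limn_einf_ge_near.
  have e120 : (0 < e1 / 2)%R by rewrite divr_gt0.
  have /cvgrPdist_le/(_ _ e120) := cVw.
  apply: filterS2 (Uusc _ e120) => i Ui; rewrite ler_norml => /andP[_ Vi].
  by rewrite lee_fin /a le_max; apply/orP; right; move: Vi; rewrite /k in Ui *; lra.
have UYVY := cond_exp_jensen sT Tm cU intf f0 intUf Y_ce Y0 VY_ce.
have Ediff : \int[P]_w (Num.max 0%R (VY w - U (Y w))%R)%:E =
    \int[P]_w (U (f w))%:E - \int[P]_w (U (Y w))%:E.
  rewrite -EVY -integralB_EFin//.
  apply: ae_eq_integral => //.
  - apply/measurable_EFinP; apply: measurable_maxr => //.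
    by apply/measurable_EFinP; exact: measurable_int intdiff.
  - exact: measurable_int intdiff.
  by apply: filterS UYVY => w h _ /=; rewrite (max_idPr _) ?subr_ge0.
have a0 i w : 0 <= (a i w)%:E by rewrite lee_fin le_max lexx.
have mEa i : measurable_fun setT (fun w => (a i w)%:E) by exact/measurable_EFinP.
have : \int[P]_w (Num.max 0%R (VY w - U (Y w))%R)%:E <=
    limn_einf (fun i => \int[P]_w (a i w)%:E).
  apply: le_trans (fatou P measurableT mEa (fun i w _ => a0 i w)).
  apply: ae_ge0_le_integral => //.
  - by move=> w _; rewrite lee_fin le_max lexx.
  - apply/measurable_EFinP; apply: measurable_maxr => //.
    by apply/measurable_EFinP; exact: measurable_int intdiff.
  - by move=> w _; apply: limn_einf_ge_near; apply: nearW => i; exact: a0.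
  - exact: measurable_fun_limn_einf.
  apply: filterS liminf_ge => w h _; rewrite EFin_max ge_max h andbT.
  by apply: limn_einf_ge_near; apply: nearW => i; exact: a0.
(* The integral of [U \o f] appears on both sides of Fatou's inequality. By [lt_n] every term on the
   right is at least [e] below the left-hand side, a contradiction. *)
apply/negP; rewrite -ltNge Ediff.
have Afin := integrable_fin_num measurableT intUf.
have Bfin := integrable_fin_num measurableT intUY.
apply: (@le_lt_trans _ _ (\int[P]_w (U (f w))%:E - (\int[P]_w (U (Y w))%:E + e%:E))).
  rewrite limn_einf_lim; apply: lime_le; first exact: is_cvg_einfs.
  apply: nearW => i; apply: (@le_trans _ _ (\int[P]_w (a i w)%:E)).
    by apply: ereal_inf_lbound; exists i => /=.
  by rewrite Ea; apply: leeB => //; exact: ltW.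
move: Afin Bfin => /=.
case: (integral _ _ (fun w => (U (f w))%:E)) => // A _.
case: (integral _ _ (fun w => (U (Y w))%:E)) => // B _.
by rewrite -EFinD -!EFinB lte_fin; lra.
Qed.


Lemma backward_entropy_le (U : R -> R) c : convex_ge0 U ->
  (forall x, 0 <= x -> c <= U x)%R -> P.-integrable setT (EFin \o (U \o f)) ->
  forall e : R, (0 < e)%R ->
  exists n, \int[P]_w (U (f_ n w))%:E <= \int[P]_w (U (Y w))%:E + e%:E.
Proof.
move=> cU Uc intUf e e0.
pose U' x := (1 * U x + - c)%R.
have cU' : convex_ge0 U'.
  move=> x y l x0 y0 l0 l1; rewrite /U' !mul1r.
  by have := cU x y l x0 y0 l0 l1; lra.
have U'0 x : (0 <= x -> 0 <= U' x)%R by move=> x0; rewrite /U' mul1r subr_ge0 Uc.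
have intU'f : P.-integrable setT (EFin \o (U' \o f)).
  exact: (integrable_affine 1 (- c) intUf).
have [n hn] := backward_entropy_le_ge0 cU' U'0 intU'f e0; exists n.
have [intUY _] := backward_entropy_ge cU Uc intUf.
have [intUfn _] := cond_exp_jensen_integrable (sG n) (@Gm n) cU Uc intf f0
  intUf (f_ce n) (f_0 n).
move: hn; rewrite /U' (integral_affine 1 (- c) intUfn measurableT).
rewrite (integral_affine 1 (- c) intUY measurableT) !mul1e probability_setT mule1.
by rewrite [leRHS]addeAC leeD2rE.
Qed.

End backward_entropy.

(** * Entropy of the marginals along the process *)

Section entropy_process.
Context (R : realType) (d dP dQ : measure_display)
    (E : measurableType d) (WP : measurableType dP) (WQ : measurableType dQ)
    (k : R -> R -> R.-pker E ~> E) (P0 Q0 : probability E R)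
    (PP : probability WP R) (PQ : probability WQ R)
    (XP : R -> {RV PP >-> E}) (XQ : R -> {RV PQ >-> E}) (U : R -> R) (c : R).
Hypotheses (mP : markov_process k P0 XP) (mQ : markov_process k Q0 XQ).
Hypotheses (cU : convex_ge0 U) (Uc : forall x, (0 <= x -> c <= U x)%R).

Let P_ s : probability E R := distribution PP (XP s).
Let Q_ s : probability E R := distribution PQ (XQ s).
Let Z s w := density (P_ s) (Q_ s) (XQ s w).
Let F := future XQ.
Let H s := U_entropy U (P_ s) (Q_ s).

Let Z0 s w : (0 <= Z s w)%R. Proof. exact: density_ge0. Qed.

Let sF s : sigma_algebra setT (F s). Proof. exact: smallest_sigma_algebra. Qed.

Let Fm s : F s `<=` measurable.
Proof. exact: sigma_process_sub_measurable. Qed.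

Let Fdecr r s : (r <= s)%R -> F s `<=` F r.
Proof. by move=> rs; apply: subset_sigma_process => u /=; exact: le_trans. Qed.

Lemma U_entropyE s : P_ s `<< Q_ s -> H s = \int[PQ]_w (U (Z s w))%:E.
Proof.
move=> pq; rewrite /H /U_entropy; case: asboolP => // _.
rewrite integral_distribution_measurable//.
apply/measurable_EFinP; apply: (measurable_convex_comp cU).
  exact: density_ge0.
exact: measurable_density.
Qed.

Lemma U_entropy_dominates s : H s < +oo -> P_ s `<< Q_ s.
Proof. by rewrite /H /U_entropy; case: asboolP. Qed.

Section finite_entropy.
Variable t : R.
Hypotheses (t0 : (0 <= t)%R) (Ht : H t < +oo).

Let pq s : (t <= s)%R -> P_ s `<< Q_ s.
Proof.
move=> ts.
exact: (marginal_dominates mP mQ t0 ts (U_entropy_dominates Ht)).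
Qed.

Let intZ s : (t <= s)%R -> PQ.-integrable setT (EFin \o Z s).
Proof. by move=> ts; exact: density_process_integrable (pq ts). Qed.

Let Z_ce r s : (t <= r)%R -> (r <= s)%R -> is_cond_exp PQ (F s) (Z r) (Z s).
Proof.
move=> tr rs.
exact: (density_process_cond_exp mP mQ (le_trans t0 tr) rs (pq tr)).
Qed.

Let intUZt : PQ.-integrable setT (EFin \o (U \o Z t)).
Proof.
apply: (@integrable_lbound _ _ _ _ _ c).
- apply: (measurable_convex_comp cU (Z0 t)).
  by apply: measurable_density_process; exact: pq.
- by move=> w; exact: Uc.
- by rewrite -[ltLHS]U_entropyE//; exact: pq.
Qed.

Lemma U_density_process_integrable s : (t <= s)%R ->
  PQ.-integrable setT (EFin \o (U \o Z s)).
Proof.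
move=> ts; have [] // := cond_exp_jensen_integrable (sF s) (@Fm s) cU Uc
  (intZ (lexx t)) (Z0 t) intUZt (Z_ce (lexx t) ts) (Z0 s).
Qed.

Lemma U_entropy_le s : (t <= s)%R -> H s <= H t.
Proof.
move=> ts; rewrite !U_entropyE; [|exact: pq|exact: pq].
by have [] := cond_exp_jensen_integrable (sF s) (@Fm s) cU Uc
  (intZ (lexx t)) (Z0 t) intUZt (Z_ce (lexx t) ts) (Z0 s).
Qed.

Lemma U_density_process_backward_submartingale :
  backward_submartingale PQ t F (fun s w => U (Z s w)).
Proof.
split.
  split; first exact: future_backward_filtration.
  move=> s ts; split; last exact: U_density_process_integrable.
  apply/(sub_measurableP (sF s)).
  apply: (@measurable_convex_comp _ _ _ (g_sigma_algebraType (F s)) _ cU (Z0 s)).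
  apply/(sub_measurableP (sF s)).
  by apply: density_process_sub_measurable; exact: pq.
move=> r s tr rs.
have intUr := U_density_process_integrable tr.
have [g Ug] := cond_exp_lbound_exists (sF s) (@Fm s) intUr (fun w => Uc (Z0 r w)).
exists g => //.
exact: (cond_exp_jensen (sF s) (@Fm s) cU (intZ tr) (Z0 r) intUr
  (Z_ce tr rs) (Z0 s) Ug).
Qed.

Let T := \bigcap_(s in [set s : R | (0 <= s)%R]) F s.

Let sT : sigma_algebra setT T.
Proof. exact: bigcap_sigma_algebra. Qed.

Let Tm : T `<=` measurable.
Proof. by move=> B /(_ 0%R (lexx 0%R)); exact: Fm. Qed.

Lemma tail_cond_exp_exists :
  exists2 Y : WQ -> R, is_cond_exp PQ T (Z t) Y & forall w, (0 <= Y w)%R.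
Proof. exact: (cond_exp_ge0_exists sT Tm (intZ (lexx t)) (Z0 t)). Qed.

Let tn_ge (n : nat) : (t <= t + n%:R)%R. Proof. by rewrite lerDl. Qed.

Let natr_ge (x : R) : exists n : nat, (x <= n%:R)%R.
Proof.
exists (Num.truncn `|x|%R).+1.
by rewrite (le_trans (ler_norm _))// ltW// truncnS_gt.
Qed.

(** The times [t + n] are cofinal and [F] decreases, so they determine the intersection over all
    nonnegative real times, including those before [t]. *)
Let tail_capE : T = \bigcap_n F (t + n%:R).
Proof.
apply/seteqP; split => B TB.
  by move=> n _; apply: TB => /=; rewrite addr_ge0.
move=> s /= s0; have [n sn] := natr_ge (s - t)%R.
by apply: (Fdecr _ (TB n Logic.I)); rewrite -lerBlDl.
Qed.

(** One integer time per [e] is enough for the upper bound, since monotonicity extends it to all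
    later real times; the lower bound at a real time comes from a later integer time. Nonnegativity
    of [Y] keeps [U] evaluated on the half-line. *)
Lemma U_entropy_cvg Y : is_cond_exp PQ T (Z t) Y -> (forall w, (0 <= Y w)%R) ->
  \int[PQ]_w (U (Y w))%:E < +oo /\
  H s @[s --> +oo%R] --> \int[PQ]_w (U (Y w))%:E.
Proof.
rewrite tail_capE => YT Y0.
have Gdecr n m : (n <= m)%N -> F (t + m%:R) `<=` F (t + n%:R).
  by move=> nm; apply: Fdecr; rewrite lerD2l ler_nat.
have ce n : is_cond_exp PQ (F (t + n%:R)) (Z t) (Z (t + n%:R)) by exact: Z_ce.
have [intUY UYle] := backward_entropy_ge (fun n => sF (t + n%:R))
  (fun n => @Fm (t + n%:R)) (intZ (lexx t)) (Z0 t) ce (fun n => Z0 (t + n%:R))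
  YT Y0 cU Uc intUZt.
have UYge := backward_entropy_le (fun n => sF (t + n%:R))
  (fun n => @Fm (t + n%:R)) Gdecr (intZ (lexx t)) (Z0 t) ce (fun n => Z0 (t + n%:R))
  YT Y0 cU Uc intUZt.
split; first exact: integrable_lty.
have Hfin s : (t <= s)%R -> H s \is a fin_num.
  move=> ts; rewrite U_entropyE; last exact: pq.
  exact: (integrable_fin_num _ (U_density_process_integrable ts)).
have Hdecr r s : (t <= r)%R -> (r <= s)%R -> H s <= H r.
  move=> tr rs; rewrite !U_entropyE; [|exact: pq|exact: pq (le_trans tr rs)].
  by have [] := cond_exp_jensen_integrable (sF s) (@Fm s) cU Uc
    (intZ tr) (Z0 r) (U_density_process_integrable tr) (Z_ce tr rs) (Z0 s).
have lH s : (t <= s)%R -> \int[PQ]_w (U (Y w))%:E <= H s.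
  move=> ts; have [n sn] := natr_ge (s - t)%R.
  apply: (@le_trans _ _ (H (t + n%:R))); last by apply: Hdecr; rewrite // -lerBlDl.
  by rewrite U_entropyE; [exact: UYle|exact: pq].
have := integrable_fin_num measurableT intUY => /= lfin.
rewrite -(fineK lfin); apply/fine_cvgP; split.
  near=> s; apply: Hfin; near: s; exact: nbhs_pinfty_ge (num_real _).
apply/cvgrPdist_le => e e0; have [n Hn] := UYge e e0.
near=> s.
have tns : (t + n%:R <= s)%R by near: s; exact: nbhs_pinfty_ge (num_real _).
have ts : (t <= s)%R by rewrite (le_trans _ tns).
have h1 := lH s ts.
have h2 : H s <= \int[PQ]_w (U (Y w))%:E + e%:E.
  apply: (le_trans (Hdecr _ _ (tn_ge n) tns)).
  by rewrite U_entropyE; [exact: Hn|exact: pq].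
rewrite /= distrC ger0_norm.
  rewrite lerBlDl -lee_fin EFinD !fineK//; exact: Hfin.
rewrite subr_ge0 -lee_fin !fineK//; exact: Hfin.
Unshelve. all: by end_near. Qed.

End finite_entropy.

Lemma U_entropy_noninc r s : (0 <= r)%R -> (r <= s)%R -> H s <= H r.
Proof.
move=> r0 rs; have [Hr|] := ltP (H r) +oo; first exact: U_entropy_le.
by rewrite leye_eq => /eqP ->; exact: leey.
Qed.

End entropy_process.

Theorem mainTheorem1 (R : realType) (d dP dQ : measure_display)
    (E : measurableType d) (WP : measurableType dP) (WQ : measurableType dQ)
    (k : R -> R -> R.-pker E ~> E) (P0 Q0 : probability E R)
    (PP : probability WP R) (PQ : probability WQ R)
    (XP : R -> {RV PP >-> E}) (XQ : R -> {RV PQ >-> E}) (U : R -> R)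
    (hk : chapman_kolmogorov k)
    (hXP : markov_process k P0 XP) (hXQ : markov_process k Q0 XQ)
    (Uconvex : @convex_function R R^o [set x : R | (0 <= x)%R] U)
    (Ubounded : has_lbound (U @` [set x : R | (0 <= x)%R])) :
  let P_ s : probability E R := distribution PP (XP s) in
  let Q_ s : probability E R := distribution PQ (XQ s) in
  let Z s w := density (P_ s) (Q_ s) (XQ s w) in
  let F := future XQ in
  (forall t : R, (0 <= t)%R -> P_ t `<< Q_ t ->
    [/\ distribution PP (path_from XP t) `<< distribution PQ (path_from XQ t),
        forall s : R, (t <= s)%R -> P_ s `<< Q_ s &
        backward_martingale PQ t F Z]) /\
  (forall t : R, (0 <= t)%R -> U_entropy U (P_ t) (Q_ t) < +oo ->
    [/\ forall s : R, (t <= s)%R -> P_ s `<< Q_ s,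
        backward_submartingale PQ t F (fun s w => U (Z s w)),
        forall r s : R, (0 <= r)%R -> (r <= s)%R ->
          U_entropy U (P_ s) (Q_ s) <= U_entropy U (P_ r) (Q_ r),
        forall s : R, (t <= s)%R ->
          U_entropy U (P_ s) (Q_ s) = 'E_PQ[fun w => U (Z s w)] &
        let is_tail_cond_exp := is_cond_exp PQ
          (\bigcap_(s in [set s : R | (0 <= s)%R]) F s) (Z t) in
        (exists2 Y : WQ -> R, is_tail_cond_exp Y & forall w, (0 <= Y w)%R) /\
        (forall Y : WQ -> R, is_tail_cond_exp Y -> (forall w, (0 <= Y w)%R) ->
          'E_PQ[U \o Y] < +oo /\
          U_entropy U (P_ s) (Q_ s) @[s --> +oo%R] --> 'E_PQ[U \o Y])]).
Proof.
move=> P_ Q_ Z F.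
have cU := convex_function_ge0 Uconvex.
have [c Uc'] := Ubounded.
have Uc (x : R) : (0 <= x -> c <= U x)%R by move=> x0; apply: Uc'; exists x.
split=> t t0 h.
  split; first exact: (path_law_dominates hXP hXQ t0 h).
    by move=> s ts; exact: (marginal_dominates hXP hXQ t0 ts h).
  exact: (density_process_backward_martingale hXP hXQ t0 h).
have pq s : (t <= s)%R -> P_ s `<< Q_ s.
  by move=> ts; exact: (marginal_dominates hXP hXQ t0 ts (U_entropy_dominates h)).
split=> //.
- exact: (U_density_process_backward_submartingale hXP hXQ cU Uc t0 h).
- by move=> r s r0 rs; exact: (U_entropy_noninc hXP hXQ cU Uc r0 rs).
- by move=> s ts; rewrite unlock; exact: (U_entropyE cU (pq s ts)).
split; first exact: (tail_cond_exp_exists hXP hXQ t0 h).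
move=> Y YT Y0; rewrite unlock.
exact: (U_entropy_cvg hXP hXQ cU Uc t0 h YT Y0).
Qed.
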